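(* Let $R$ and $S$ be rings, $M$ an $R$-$S$-bimodule, $\Lambda=\begin{pmatrix}R&M\\ 0&S\end{pmatrix}$ the formal triangular matrix ring, $n\geqslant 1$ an integer, $\mathcal{X},\mathcal{M}$ classes of left $R$-modules and $\mathcal{Y},\mathcal{N}$ classes of left $S$-modules. (1) Let $(\mathcal{X},\mathcal{M})$ be a hereditary left $n$-cotorsion pair in $R$-$\mathrm{Mod}$ and $(\mathcal{Y},\mathcal{N})$ a hereditary left $n$-cotorsion pair in $S$-$\mathrm{Mod}$. Assume that $\mathrm{Ext}_R^j(M,\mathcal{M})=0$ for each $1\leqslant j\leqslant n$, and $(\mathfrak{D}_{\mathcal{N}}^{\mathcal{M}})_{n-1}^{\wedge}$ is closed under extensions. Then $\left(\begin{pmatrix}\mathcal{X}\\ \mathcal{Y}\end{pmatrix},\mathfrak{D}_{\mathcal{N}}^{\mathcal{M}}\right)$ is a hereditary left $n$-cotorsion pair in $\Lambda$-$\mathrm{Mod}$. (2) Let $(\mathcal{X},\mathcal{M})$ be a hereditary right $n$-cotorsion pair in $R$-$\mathrm{Mod}$ and $(\mathcal{Y},\mathcal{N})$ a hereditary right $n$-cotorsion pair in $S$-$\mathrm{Mod}$. Assume that $\mathrm{Tor}_j^S(M,\mathcal{Y})=0$ for each $1\leqslant j\leqslant n$, and $(\mathfrak{B}_{\mathcal{Y}}^{\mathcal{X}})_{n-1}^{\vee}$ is closed under extensions. Then $\left(\mathfrak{B}_{\mathcal{Y}}^{\mathcal{X}},\begin{pmatrix}\mathcal{M}\\ \mathcal{N}\end{pmatrix}\right)$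 is a hereditary right $n$-cotorsion pair in $\Lambda$-$\mathrm{Mod}$.
   Context: Rings are associative with identity, modules are unitary, and $S$-$\mathrm{Mod}$ is the category of left $S$-modules. Classes of modules contain $0$ and are closed under isomorphisms. $\mathrm{Ext}_R^j(M,\mathcal{M})=0$ means vanishing for every module in the class $\mathcal{M}$, and similarly for $\mathrm{Tor}$. A left $\Lambda$-module is identified with a triple $\begin{pmatrix}X\\ Y\end{pmatrix}_{\varphi}$, where $X\in R$-$\mathrm{Mod}$, $Y\in S$-$\mathrm{Mod}$ and $\varphi:M\otimes_S Y\to X$ is $R$-linear; morphisms to $\begin{pmatrix}X_1\\ Y_1\end{pmatrix}_{\varphi_1}$ are pairs $(f:X\to X_1,\,g:Y\to Y_1)$ with $\varphi_1(M\otimes_S g)=f\varphi$. The map $\varphi^M:Y\to\mathrm{Hom}_R(M,X)$ is $\varphi^M(y)(m)=\varphi(m\otimes y)$. $\begin{pmatrix}\mathcal{P}\\ \mathcal{Q}\end{pmatrix}$ is the class of left $\Lambda$-modules with first component in $\mathcal{P}$ and second component in $\mathcal{Q}$. $\mathfrak{B}_{\mathcal{Y}}^{\mathcal{X}}$ is the class of $\begin{pmatrix}X\\ Y\end{pmatrix}_{\varphi}$ with $Y\in\mathcal{Y}$, $\mathrm{Ker}\,\varphi=0$ and $\mathrm{Coker}\,\varphi\in\mathcal{X}$. $\mathfrak{D}_{\mathcal{N}}^{\mathcal{M}}$ is the class of $\begin{pmatrix}Z\\ N\end{pmatrix}_{\varphi}$ with $Z\in\mathcal{M}$, $\mathrm{Ker}\,\varphi^M\in\mathcal{N}$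 and $\mathrm{Coker}\,\varphi^M=0$. For a class $\mathcal{C}$ of objects of an abelian category and $m\geqslant 0$: $\mathcal{C}_m^{\wedge}$ is the class of objects $A$ admitting an exact sequence $0\to C_k\to\cdots\to C_0\to A\to 0$ with all $C_i\in\mathcal{C}$ and some $k\leqslant m$; $\mathcal{C}_m^{\vee}$ is the class of objects $A$ admitting an exact sequence $0\to A\to C^0\to\cdots\to C^k\to 0$ with all $C^i\in\mathcal{C}$ and some $k\leqslant m$. A pair $(\mathcal{C},\mathcal{D})$ of classes of objects in an abelian category is a left $n$-cotorsion pair if (i) $\mathcal{C}$ is closed under direct summands, (ii) $\mathrm{Ext}^i(C,D)=0$ for all $1\leqslant i\leqslant n$, $C\in\mathcal{C}$, $D\in\mathcal{D}$, and (iii) every object $A$ admits a short exact sequence $0\to K\to C\to A\to 0$ with $C\in\mathcal{C}$, $K\in\mathcal{D}_{n-1}^{\wedge}$. It is a right $n$-cotorsion pair if (i') $\mathcal{D}$ is closed under direct summands, (ii) holds, and (iii') every object $A$ admits a short exact sequence $0\to A\to D\to K\to 0$ with $D\in\mathcal{D}$, $K\in\mathcal{C}_{n-1}^{\vee}$. A left or right $n$-cotorsion pair $(\mathcal{C},\mathcal{D})$ is hereditary if $\mathrm{Ext}^{n+1}(C,D)=0$ for all $C\in\mathcal{C}$, $D\in\mathcal{D}$. *)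

(* Defs.v *)
From HB Require Import structures.
From mathcomp Require Import all_boot all_algebra.
From mathcomp Require Import boolp.

Set Implicit Arguments.
Unset Strict Implicit.
Unset Printing Implicit Defensive.

Import GRing.Theory.

Local Open Scope ring_scope.
Local Open Scope quotient_scope.

Definition is_zero (V : zmodType) : Prop := forall v : V, v = 0.

Definition mono (U V : Type) (f : U -> V) : Prop := injective f.
Definition epi (U V : Type) (f : U -> V) : Prop := forall v, exists u, f u = v.

(* Exactness of U --f--> V --g--> W at V, i.e. Ker g = Im f. *)
Definition exact_at (U V W : zmodType) (f : U -> V) (g : V -> W) : Prop :=
  forall v, g v = 0 <-> exists u, f u = v.

Definition short_exact (U V W : zmodType) (f : U -> V) (g : V -> W) : Prop :=
  [/\ mono f, exact_at f g & epi g].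

Definition lmod_iso (R : pzRingType) (U V : lmodType R) : Prop :=
  exists f : {linear U -> V}, mono f /\ epi f.

Section KernelCokernel.
Variables (R : pzRingType) (U V : lmodType R) (f : {linear U -> V}).

Definition in_ker : {pred U} := fun u => f u == 0.

Fact in_ker_submod : submod_closed in_ker.
Proof.
split=> [|a u v]; first by rewrite unfold_in /in_ker linear0.
rewrite !unfold_in /in_ker => /eqP fu /eqP fv.
by rewrite linearP fu fv scaler0 addr0.
Qed.

HB.instance Definition _ := GRing.isSubmodClosed.Build R U in_ker in_ker_submod.

Definition ker : Type := {u : U | in_ker u}.
HB.instance Definition _ := Choice.on ker.
HB.instance Definition _ := SubType.on ker.
HB.instance Definition _ := [SubChoice_isSubLmodule of ker by <:].

Definition in_im : {pred V} := fun v => `[< exists u, f u = v >].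

Fact in_im_submod : submod_closed in_im.
Proof.
split=> [|a v w]; first by apply/asboolP; exists 0; rewrite linear0.
move=> /asboolP[u1 <-] /asboolP[u2 <-]; apply/asboolP.
by exists (a *: u1 + u2); rewrite linearP.
Qed.

HB.instance Definition _ := GRing.isSubmodClosed.Build R V in_im in_im_submod.

Definition coker : Type := Quotient.quot in_im.
HB.instance Definition _ := Choice.on coker.
HB.instance Definition _ := GRing.Zmodule.on coker.

Definition coker_proj (v : V) : coker := \pi_(Quotient.quot in_im) v.

Fact coker_projB : zmod_morphism coker_proj.
Proof. by move=> v w; rewrite /coker_proj Quotient.pi_add Quotient.pi_opp. Qed.

Fact coker_proj_eq v w : coker_proj v = coker_proj w <-> exists u, f u = v - w.
Proof.
split=> [/eqP|[u fu]].
  by rewrite /coker_proj -Quotient.idealrBE => /asboolP.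
by apply/eqP; rewrite /coker_proj -Quotient.idealrBE; apply/asboolP; exists u.
Qed.

Fact coker_projK (c : coker) : coker_proj (repr c) = c.
Proof. exact: reprK. Qed.

Definition coker_scale (a : R) (c : coker) : coker :=
  coker_proj (a *: repr c).

Fact coker_projZ a v : coker_proj (a *: v) = coker_scale a (coker_proj v).
Proof.
apply/coker_proj_eq.
have /coker_proj_eq[u fu] : coker_proj v = coker_proj (repr (coker_proj v)).
  by rewrite coker_projK.
by exists (a *: u); rewrite linearZ /= fu scalerBr.
Qed.

Fact coker_scalerA a b c :
  coker_scale a (coker_scale b c) = coker_scale (a * b) c.
Proof. by rewrite -[c]coker_projK -!coker_projZ scalerA. Qed.

Fact coker_scale1r : left_id 1 coker_scale.
Proof. by move=> c; rewrite -[c]coker_projK -coker_projZ scale1r. Qed.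

Fact coker_scalerDr : right_distributive coker_scale +%R.
Proof.
move=> a c d; rewrite -[c]coker_projK -[d]coker_projK.
rewrite -!coker_projZ -[coker_proj _ + _]Quotient.pi_add.
rewrite -[_ + coker_proj _]Quotient.pi_add.
by rewrite -[RHS]/(coker_proj _) -scalerDr coker_projZ.
Qed.

Fact coker_scalerDl c : {morph coker_scale^~ c : a b / a + b}.
Proof.
move=> a b; rewrite -[c]coker_projK -!coker_projZ scalerDl.
exact: Quotient.pi_add.
Qed.

HB.instance Definition _ := GRing.Zmodule_isLmodule.Build R coker
  coker_scalerA coker_scale1r coker_scalerDr coker_scalerDl.

HB.instance Definition _ :=
  GRing.isZmodMorphism.Build V coker coker_proj coker_projB.
HB.instance Definition _ :=
  GRing.isScalable.Build R V coker *:%R coker_proj coker_projZ.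

End KernelCokernel.

(* An R-S-bimodule: a left R-module with a compatible right action of S. *)
HB.mixin Record Lmodule_isBimodule (R S : pzRingType) M of GRing.Lmodule R M := {
  ract : M -> S -> M;
  ractDl : forall s, {morph ract^~ s : x y / x + y};
  ractDr : forall x, {morph ract x : s t / s + t};
  ractA : forall x s t, ract (ract x s) t = ract x (s * t);
  ract1 : forall x, ract x 1 = x;
  ractZ : forall (r : R) x s, ract (r *: x) s = r *: ract x s
}.

#[short(type="bimodType")]
HB.structure Definition Bimodule (R S : pzRingType) :=
  {M of Lmodule_isBimodule R S M & GRing.Lmodule R M}.

Section Tensor.
Variables (R S : pzRingType) (M : bimodType R S) (Y : lmodType S).

(* M (x)_S Y is the monoid of formal sums m1 (x) y1 + ... + mk (x) yk, encoded
   as sequences of pairs, modulo the smallest congruence making (x) additive in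
   each variable and S-balanced.  The rule for 0 makes the quotient a group,
   the opposite of m (x) y being (- m) (x) y. *)
Inductive tensor_eq : seq (M * Y) -> seq (M * Y) -> Prop :=
| tensor_eq_refl s : tensor_eq s s
| tensor_eq_sym s t : tensor_eq s t -> tensor_eq t s
| tensor_eq_trans s t u : tensor_eq s t -> tensor_eq t u -> tensor_eq s u
| tensor_eq_cat s s' t t' :
    tensor_eq s s' -> tensor_eq t t' -> tensor_eq (s ++ t) (s' ++ t')
| tensor_eq_comm s t : tensor_eq (s ++ t) (t ++ s)
| tensor_eq0 y : tensor_eq [:: (0, y)] [::]
| tensor_eqDl m m' y : tensor_eq [:: (m + m', y)] [:: (m, y); (m', y)]
| tensor_eqDr m y y' : tensor_eq [:: (m, y + y')] [:: (m, y); (m, y')]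
| tensor_eq_bal m a y : tensor_eq [:: (ract m a, y)] [:: (m, a *: y)].

Definition tensor_rel (s t : seq (M * Y)) : bool := `[< tensor_eq s t >].

Fact tensor_rel_equiv : equiv_class_of tensor_rel.
Proof.
split=> [s|s t|t s u].
- exact/asboolP/tensor_eq_refl.
- by apply/idP/idP => /asboolP st; apply/asboolP/tensor_eq_sym.
- by move=> /asboolP st /asboolP tu; apply/asboolP/(tensor_eq_trans st tu).
Qed.

Canonical tensor_equiv := EquivRelPack tensor_rel_equiv.

Definition tensor : Type := {eq_quot tensor_rel}.
HB.instance Definition _ := Choice.on tensor.

Definition tensor_class (s : seq (M * Y)) : tensor := \pi_{eq_quot tensor_rel} s.

Fact tensor_classP s t : tensor_class s = tensor_class t <-> tensor_eq s t.
Proof.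
split=> [/eqP|st]; first by rewrite eqmodE => /asboolP.
by apply/eqP; rewrite eqmodE; apply/asboolP.
Qed.

Definition tensor_repr (u : tensor) : seq (M * Y) := repr u.

Fact tensor_reprK u : tensor_class (tensor_repr u) = u.
Proof. exact: reprK. Qed.

Fact tensor_repr_eq s : tensor_eq (tensor_repr (tensor_class s)) s.
Proof. by apply/tensor_classP; rewrite tensor_reprK. Qed.

Definition tensor_zero : tensor := tensor_class [::].
Definition tensor_add (u v : tensor) : tensor :=
  tensor_class (tensor_repr u ++ tensor_repr v).

Fact tensor_class_cat s t :
  tensor_class (s ++ t) = tensor_add (tensor_class s) (tensor_class t).
Proof.
apply/tensor_classP/tensor_eq_sym.
by apply: tensor_eq_cat; exact: tensor_repr_eq.
Qed.

Definition tensor_mapl (f : M -> M) (s : seq (M * Y)) : seq (M * Y) :=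
  [seq (f p.1, p.2) | p <- s].

Fact tensor_mapl_eq (f : M -> M) (f0 : f 0 = 0) (fD : {morph f : x y / x + y})
    (fr : forall x a, f (ract x a) = ract (f x) a) s t :
  tensor_eq s t -> tensor_eq (tensor_mapl f s) (tensor_mapl f t).
Proof.
elim=> {s t} [s|s t _ IH|s t u _ IH1 _ IH2|s s' t t' _ IH1 _ IH2|s t|y|m m' y
             |m y y'|m a y] /=.
- exact: tensor_eq_refl.
- exact: tensor_eq_sym.
- exact: tensor_eq_trans IH1 IH2.
- by rewrite /tensor_mapl !map_cat; exact: tensor_eq_cat.
- by rewrite /tensor_mapl !map_cat; exact: tensor_eq_comm.
- by rewrite f0; exact: tensor_eq0.
- by rewrite fD; exact: tensor_eqDl.
- exact: tensor_eqDr.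
- by rewrite fr; exact: tensor_eq_bal.
Qed.

Fact ract0 (a : S) : ract (0 : M) a = 0.
Proof. by apply: (addrI (ract 0 a)); rewrite -ractDl !addr0. Qed.

Fact ractN (x : M) (a : S) : ract (- x) a = - ract x a.
Proof. by apply: (addrI (ract x a)); rewrite -ractDl !subrr ract0. Qed.

Definition tensor_opp (u : tensor) : tensor :=
  tensor_class (tensor_mapl -%R (tensor_repr u)).
Definition tensor_scale (r : R) (u : tensor) : tensor :=
  tensor_class (tensor_mapl ( *:%R r) (tensor_repr u)).

Fact tensor_class_opp s :
  tensor_class (tensor_mapl -%R s) = tensor_opp (tensor_class s).
Proof.
apply/tensor_classP/tensor_mapl_eq; [exact: oppr0|exact: opprD| |].
  by move=> x a; rewrite ractN.
exact/tensor_eq_sym/tensor_repr_eq.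
Qed.

Fact tensor_class_scale r s :
  tensor_class (tensor_mapl ( *:%R r) s) = tensor_scale r (tensor_class s).
Proof.
apply/tensor_classP/tensor_mapl_eq; [exact: scaler0|exact: scalerDr| |].
  by move=> x a; rewrite ractZ.
exact/tensor_eq_sym/tensor_repr_eq.
Qed.

Fact tensor_addA : associative tensor_add.
Proof.
move=> u v w; rewrite -[u]tensor_reprK -[v]tensor_reprK -[w]tensor_reprK.
by rewrite -!tensor_class_cat catA.
Qed.

Fact tensor_addC : commutative tensor_add.
Proof. by move=> u v; exact/tensor_classP/tensor_eq_comm. Qed.

Fact tensor_add0 : left_id tensor_zero tensor_add.
Proof. by move=> u; rewrite -[u]tensor_reprK -tensor_class_cat. Qed.

Fact tensor_addN : left_inverse tensor_zero tensor_opp tensor_add.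
Proof.
move=> u; rewrite -[u]tensor_reprK -tensor_class_opp -tensor_class_cat.
elim: (tensor_repr u) => [//|[m y] s IHs].
rewrite -[_ ++ _]/([:: (- m, y)] ++ (tensor_mapl -%R s ++ ([:: (m, y)] ++ s))).
rewrite !tensor_class_cat [X in tensor_add _ X]tensor_addA.
rewrite [tensor_add (tensor_class (tensor_mapl _ _)) _]tensor_addC.
rewrite -[X in tensor_add _ X]tensor_addA -[X in tensor_add _ (tensor_add _ X)]
  tensor_class_cat IHs tensor_addA -!tensor_class_cat cats0.
apply/tensor_classP; apply: (tensor_eq_trans _ (tensor_eq0 y)).
by rewrite -(addNr m); exact/tensor_eq_sym/tensor_eqDl.
Qed.

HB.instance Definition _ := GRing.isZmodule.Build tensor
  tensor_addA tensor_addC tensor_add0 tensor_addN.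

Fact tensor_scalerA a b u :
  tensor_scale a (tensor_scale b u) = tensor_scale (a * b) u.
Proof.
rewrite -[u]tensor_reprK -!tensor_class_scale /tensor_mapl -map_comp.
by congr tensor_class; apply: eq_map => p /=; rewrite scalerA.
Qed.

Fact tensor_scale1r : left_id 1 tensor_scale.
Proof.
move=> u; rewrite -[u]tensor_reprK -!tensor_class_scale /tensor_mapl.
by congr tensor_class; rewrite -[RHS]map_id; apply: eq_map => -[m y] /=;
  rewrite scale1r.
Qed.

Fact tensor_scalerDr : right_distributive tensor_scale +%R.
Proof.
move=> a u v; rewrite -[u]tensor_reprK -[v]tensor_reprK.
rewrite -[_ + _]tensor_class_cat -!tensor_class_scale -[RHS]tensor_class_cat.
by rewrite /tensor_mapl map_cat.
Qed.

Fact tensor_scalerDl u : {morph tensor_scale^~ u : a b / a + b}.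
Proof.
move=> a b; rewrite -[u]tensor_reprK -!tensor_class_scale -[RHS]tensor_class_cat.
elim: (tensor_repr u) => [//|[m y] s IHs].
rewrite -[tensor_mapl _ _]/([:: ((a + b) *: m, y)] ++ tensor_mapl ( *:%R (a + b)) s).
rewrite -[RHS]/(tensor_class (([:: (a *: m, y)] ++ tensor_mapl ( *:%R a) s)
  ++ ([:: (b *: m, y)] ++ tensor_mapl ( *:%R b) s))).
move: IHs; rewrite !tensor_class_cat => ->.
have -> : tensor_class [:: ((a + b) *: m, y)]
  = tensor_add (tensor_class [:: (a *: m, y)]) (tensor_class [:: (b *: m, y)]).
  by rewrite -tensor_class_cat scalerDl; exact/tensor_classP/tensor_eqDl.
exact: (addrACA (tensor_class _ : tensor)).
Qed.

HB.instance Definition _ := GRing.Zmodule_isLmodule.Build R tensor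
  tensor_scalerA tensor_scale1r tensor_scalerDr tensor_scalerDl.

Definition pure (m : M) (y : Y) : tensor := tensor_class [:: (m, y)].

Fact pureDl m m' y : pure (m + m') y = pure m y + pure m' y.
Proof.
by rewrite -[RHS]tensor_class_cat; exact/tensor_classP/tensor_eqDl.
Qed.

Fact pureDr m y y' : pure m (y + y') = pure m y + pure m y'.
Proof.
by rewrite -[RHS]tensor_class_cat; exact/tensor_classP/tensor_eqDr.
Qed.

Fact pure_bal m a y : pure (ract m a) y = pure m (a *: y).
Proof. exact/tensor_classP/tensor_eq_bal. Qed.

Fact pureZ r m y : pure (r *: m) y = r *: pure m y.
Proof. by rewrite -[RHS]tensor_class_scale. Qed.

Fact tensor_classE s : tensor_class s = \sum_(p <- s) pure p.1 p.2.
Proof.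
elim: s => [|[m y] s IHs]; first by rewrite big_nil.
by rewrite big_cons -IHs -[RHS]tensor_class_cat.
Qed.

End Tensor.

Section TensorMap.
Variables (R S : pzRingType) (M : bimodType R S) (Y Y' : lmodType S).
Variable g : {linear Y -> Y'}.

Let mapr (s : seq (M * Y)) : seq (M * Y') := [seq (p.1, g p.2) | p <- s].

(* M (x)_S g *)
Definition tensor_map (u : tensor M Y) : tensor M Y' :=
  tensor_class (mapr (tensor_repr u)).

Let mapr_eq s t : tensor_eq s t -> tensor_eq (mapr s) (mapr t).
Proof.
rewrite /mapr; elim=> {s t} [s|s t _ IH|s t u _ IH1 _ IH2
             |s s' t t' _ IH1 _ IH2|s t|y|m m' y|m y y'|m a y] /=.
- exact: tensor_eq_refl.
- exact: tensor_eq_sym.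
- exact: tensor_eq_trans IH1 IH2.
- by rewrite !map_cat; exact: tensor_eq_cat.
- by rewrite !map_cat; exact: tensor_eq_comm.
- exact: tensor_eq0.
- exact: tensor_eqDl.
- by rewrite linearD; exact: tensor_eqDr.
- by rewrite linearZ; exact: tensor_eq_bal.
Qed.

Let tensor_map_class s : tensor_map (tensor_class s) = tensor_class (mapr s).
Proof. exact/tensor_classP/mapr_eq/tensor_repr_eq. Qed.

Fact tensor_map_pure m y : tensor_map (pure m y) = pure m (g y).
Proof. exact: tensor_map_class. Qed.

Fact tensor_map_linear : linear tensor_map.
Proof.
move=> r u v; rewrite -[u]tensor_reprK -[v]tensor_reprK.
rewrite -[r *: _]tensor_class_scale -[X in tensor_map X]tensor_class_cat.
rewrite !tensor_map_class -[r *: _]tensor_class_scale -[RHS]tensor_class_cat.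
by rewrite /mapr /tensor_mapl map_cat -!map_comp.
Qed.

HB.instance Definition _ := GRing.isLinear.Build R (tensor M Y) (tensor M Y')
  *:%R tensor_map tensor_map_linear.

End TensorMap.

Section HomModule.
Variables (R S : pzRingType) (M : bimodType R S) (X : lmodType R).

Definition hom_mod : Type := {linear M -> X}.
Definition hom_fun (h : hom_mod) : M -> X := (h : {linear M -> X}).

Fact hom_eq (h k : hom_mod) : hom_fun h =1 hom_fun k -> h = k.
Proof.
case: h => f [[hf1] [hf2]]; case: k => g [[hg1] [hg2]] /= /funext fg.
rewrite /hom_fun /= in fg; case: _ / fg in hg1 hg2 *.
by rewrite (Prop_irrelevance hf1 hg1) (Prop_irrelevance hf2 hg2).
Qed.

HB.instance Definition _ := gen_eqMixin hom_mod.
HB.instance Definition _ := gen_choiceMixin hom_mod.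

Definition hom_zero : hom_mod := (\0 : {linear M -> X}).
Definition hom_opp (h : hom_mod) : hom_mod :=
  (\- (h : {linear M -> X}) : {linear M -> X}).
Definition hom_add (h k : hom_mod) : hom_mod :=
  ((h : {linear M -> X}) \+ (k : {linear M -> X}) : {linear M -> X}).

Fact hom_addA : associative hom_add.
Proof. by move=> h k l; apply: hom_eq => m /=; exact: addrA. Qed.
Fact hom_addC : commutative hom_add.
Proof. by move=> h k; apply: hom_eq => m /=; exact: addrC. Qed.
Fact hom_add0 : left_id hom_zero hom_add.
Proof. by move=> h; apply: hom_eq => m /=; exact: add0r. Qed.
Fact hom_addN : left_inverse hom_zero hom_opp hom_add.
Proof. by move=> h; apply: hom_eq => m /=; exact: addNr. Qed.

HB.instance Definition _ :=
  GRing.isZmodule.Build hom_mod hom_addA hom_addC hom_add0 hom_addN.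

Definition hom_scale_fun (s : S) (h : hom_mod) (m : M) : X := hom_fun h (ract m s).

Fact hom_scale_linear s h : linear (hom_scale_fun s h).
Proof.
move=> r m m'; rewrite /hom_scale_fun /hom_fun ractDl ractZ.
by rewrite linearP.
Qed.

HB.instance Definition _ s h := GRing.isLinear.Build R M X *:%R
  (hom_scale_fun s h) (hom_scale_linear s h).

Definition hom_scale (s : S) (h : hom_mod) : hom_mod :=
  (hom_scale_fun s h : {linear M -> X}).

Fact hom_scalerA s t h : hom_scale s (hom_scale t h) = hom_scale (s * t) h.
Proof.
by apply: hom_eq => m; rewrite /hom_fun /= /hom_scale_fun /hom_fun /=
  /hom_scale_fun ractA.
Qed.

Fact hom_scale1r : left_id 1 hom_scale.
Proof.
by move=> h; apply: hom_eq => m; rewrite /hom_fun /= /hom_scale_fun ract1.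
Qed.

Fact hom_scalerDr : right_distributive hom_scale +%R.
Proof. by move=> s h k; apply: hom_eq. Qed.

Fact hom_scalerDl h : {morph hom_scale^~ h : s t / s + t}.
Proof.
move=> s t; apply: hom_eq => m; rewrite /hom_fun /= /hom_scale_fun ractDr.
exact: linearD.
Qed.

HB.instance Definition _ := GRing.Zmodule_isLmodule.Build S hom_mod
  hom_scalerA hom_scale1r hom_scalerDr hom_scalerDl.

End HomModule.

Section Adjoint.
Variables (R S : pzRingType) (M : bimodType R S) (X : lmodType R).
Variables (Y : lmodType S) (phi : {linear tensor M Y -> X}).

Definition adjoint_fun (y : Y) (m : M) : X := phi (pure m y).

Fact adjoint_fun_linear y : linear (adjoint_fun y).
Proof.
by move=> r m m'; rewrite /adjoint_fun pureDl pureZ linearP.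
Qed.

HB.instance Definition _ y := GRing.isLinear.Build R M X *:%R
  (adjoint_fun y) (adjoint_fun_linear y).

(* y |-> (m |-> phi (m (x) y)) *)
Definition adjoint (y : Y) : hom_mod M X := (adjoint_fun y : {linear M -> X}).

Fact adjoint_linear : linear adjoint.
Proof.
move=> s y y'; apply: hom_eq => m.
rewrite /hom_fun /= /adjoint_fun pureDr linearD; congr (_ + _).
by rewrite /hom_scale_fun /hom_fun /= /adjoint_fun pure_bal.
Qed.

HB.instance Definition _ := GRing.isLinear.Build S Y (hom_mod M X) *:%R
  adjoint adjoint_linear.

End Adjoint.

Section TriangularRing.
Variables (R S : pzRingType) (M : bimodType R S).

(* (r, m, s) is the matrix with rows (r m) and (0 s). *)
Definition tri_ring : Type := (R * M * S)%type.
HB.instance Definition _ := GRing.Zmodule.on tri_ring.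

Definition tri_one : tri_ring := (1, 0, 1).
Definition tri_mul (a b : tri_ring) : tri_ring :=
  let: (r, m, s) := a in let: (r', m', s') := b in
  (r * r', r *: m' + ract m s', s * s').

Fact tri_mulA : associative tri_mul.
Proof.
move=> [[r m] s] [[r' m'] s'] [[r'' m''] s''] /=.
by rewrite !mulrA scalerDr scalerA ractDl ractA ractZ addrA.
Qed.
Fact tri_mul1 : left_id tri_one tri_mul.
Proof. by move=> [[r m] s] /=; rewrite !mul1r scale1r ract0 addr0. Qed.
Fact tri_mulr1 : right_id tri_one tri_mul.
Proof. by move=> [[r m] s] /=; rewrite !mulr1 scaler0 ract1 add0r. Qed.
Fact tri_mulDl : left_distributive tri_mul +%R.
Proof.
move=> [[r m] s] [[r' m'] s'] [[r'' m''] s''] /=.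
by congr (_, _, _); rewrite /= ?mulrDl // scalerDl ractDl addrACA.
Qed.
Fact tri_mulDr : right_distributive tri_mul +%R.
Proof.
move=> [[r m] s] [[r' m'] s'] [[r'' m''] s''] /=.
by congr (_, _, _); rewrite /= ?mulrDr // scalerDr ractDr addrACA.
Qed.

HB.instance Definition _ := GRing.Zmodule_isPzRing.Build tri_ring
  tri_mulA tri_mul1 tri_mulr1 tri_mulDl tri_mulDr.

Record triple : Type := Triple {
  fstc : lmodType R;
  sndc : lmodType S;
  structmap : {linear tensor M sndc -> fstc}
}.

(* The left module over the triangular ring attached to (X, Y, phi): the
   additive group X + Y, with (r, m, s) (x, y) = (r x + phi (m (x) y), s y). *)
Definition tri_mod (T : triple) : Type := (fstc T * sndc T)%type.
HB.instance Definition _ T := GRing.Zmodule.on (tri_mod T).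

Section TriMod.
Variable T : triple.

Definition tri_scale (a : tri_ring) (v : tri_mod T) : tri_mod T :=
  let: (r, m, s) := a in let: (x, y) := v in
  (r *: x + structmap T (pure m y), s *: y).

Fact tri_scalerA a b v : tri_scale a (tri_scale b v) = tri_scale (a * b) v.
Proof.
move: a b v => [[r m] s] [[r' m'] s'] [x y] /=.
by rewrite scalerDr !scalerA -linearZ -addrA -linearD -pureZ -pure_bal -pureDl.
Qed.
Fact tri_scale1r : left_id 1 tri_scale.
Proof.
move=> [x y] /=; rewrite !scale1r.
by rewrite -(scale0r (0 : M)) pureZ scale0r linear0 addr0.
Qed.
Fact tri_scalerDr : right_distributive tri_scale +%R.
Proof.
move=> [[r m] s] [x y] [x' y'] /=.
by congr (_, _); rewrite /= ?scalerDr // pureDr linearD addrACA.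
Qed.
Fact tri_scalerDl v : {morph tri_scale^~ v : a b / a + b}.
Proof.
move: v => [x y] [[r m] s] [[r' m'] s'] /=.
by congr (_, _); rewrite /= ?scalerDl // pureDl linearD addrACA.
Qed.

HB.instance Definition _ := GRing.Zmodule_isLmodule.Build tri_ring (tri_mod T)
  tri_scalerA tri_scale1r tri_scalerDr tri_scalerDl.

End TriMod.
End TriangularRing.

Definition modclass (R : pzRingType) : Type := lmodType R -> Prop.

Definition class_axioms (R : pzRingType) (C : modclass R) : Prop :=
  (forall U : lmodType R, is_zero U -> C U) /\
  (forall U V : lmodType R, lmod_iso U V -> C U -> C V).

(* 0 <- A <- P_0 <- P_1 <- ... exact *)
Record resolution (R : pzRingType) (A : lmodType R) : Type := Resolution {
  res_obj : nat -> lmodType R;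
  res_dif : forall i, {linear res_obj i.+1 -> res_obj i};
  res_aug : {linear res_obj 0 -> A};
  res_epi : epi res_aug;
  res_exact0 : exact_at (res_dif 0) res_aug;
  res_exact : forall i, exact_at (res_dif i.+1) (res_dif i)
}.

(* 0 -> A -> I^0 -> I^1 -> ... exact *)
Record coresolution (R : pzRingType) (A : lmodType R) : Type := Coresolution {
  cores_obj : nat -> lmodType R;
  cores_dif : forall i, {linear cores_obj i -> cores_obj i.+1};
  cores_aug : {linear A -> cores_obj 0};
  cores_mono : mono cores_aug;
  cores_exact0 : exact_at cores_aug (cores_dif 0);
  cores_exact : forall i, exact_at (cores_dif i) (cores_dif i.+1)
}.

(* The classes C_m^wedge and C_m^vee; a finite (co)resolution is one whose
   terms vanish from some index on. *)
Definition wedge (R : pzRingType) (C : modclass R) (m : nat) : modclass R :=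
  fun A => exists (P : resolution A) (k : nat),
    [/\ (k <= m)%N,
        forall i, (i <= k)%N -> C (res_obj P i) &
        forall i, (k < i)%N -> is_zero (res_obj P i)].

Definition vee (R : pzRingType) (C : modclass R) (m : nat) : modclass R :=
  fun A => exists (I : coresolution A) (k : nat),
    [/\ (k <= m)%N,
        forall i, (i <= k)%N -> C (cores_obj I i) &
        forall i, (k < i)%N -> is_zero (cores_obj I i)].

Definition projective (R : pzRingType) (P : lmodType R) : Prop :=
  forall (U V : lmodType R) (g : {linear U -> V}) (f : {linear P -> V}),
    epi g -> exists h : {linear P -> U}, forall x, g (h x) = f x.

Definition proj_resolution (R : pzRingType) (A : lmodType R)
    (P : resolution A) : Prop :=
  forall i, projective (res_obj P i).

(* Vanishing of H^i (Hom (P, B)): every cocycle P_i -> B is a coboundary. *)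
Definition Ext_zero (R : pzRingType) (i : nat) (A B : lmodType R) : Prop :=
  forall P : resolution A, proj_resolution P ->
  match i with
  | 0 => forall f : {linear res_obj P 0 -> B},
      (forall x, f (res_dif P 0 x) = 0) -> forall x, f x = 0
  | j.+1 => forall f : {linear res_obj P j.+1 -> B},
      (forall x, f (res_dif P j.+1 x) = 0) ->
      exists g : {linear res_obj P j -> B}, forall x, f x = g (res_dif P j x)
  end.

(* Vanishing of H_i (M (x)_S P): every cycle is a boundary. *)
Definition Tor_zero (R S : pzRingType) (i : nat) (M : bimodType R S)
    (Y : lmodType S) : Prop :=
  forall P : resolution Y, proj_resolution P ->
  match i with
  | 0 => forall u : tensor M (res_obj P 0),
      exists v, tensor_map (res_dif P 0) v = u
  | j.+1 => forall u : tensor M (res_obj P j.+1),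
      tensor_map (res_dif P j) u = 0 ->
      exists v, tensor_map (res_dif P j.+1) v = u
  end.

Section Cotorsion.
Variable R : pzRingType.
Implicit Types C D : modclass R.

Definition closed_summands C : Prop :=
  forall U V W : lmodType R, lmod_iso W (U * V)%type -> C W -> C U.

Definition closed_extensions C : Prop :=
  forall (U V W : lmodType R) (f : {linear U -> V}) (g : {linear V -> W}),
    short_exact f g -> C U -> C W -> C V.

Definition left_cotorsion (n : nat) C D : Prop :=
  [/\ closed_summands C,
      forall i, (1 <= i <= n)%N -> forall U V, C U -> D V -> Ext_zero i U V &
      forall A : lmodType R, exists (K U : lmodType R)
        (f : {linear K -> U}) (g : {linear U -> A}),
        [/\ short_exact f g, C U & wedge D n.-1 K]].

Definition right_cotorsion (n : nat) C D : Prop :=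
  [/\ closed_summands D,
      forall i, (1 <= i <= n)%N -> forall U V, C U -> D V -> Ext_zero i U V &
      forall A : lmodType R, exists (V K : lmodType R)
        (f : {linear A -> V}) (g : {linear V -> K}),
        [/\ short_exact f g, D V & vee C n.-1 K]].

Definition hereditary (n : nat) C D : Prop :=
  forall U V, C U -> D V -> Ext_zero n.+1 U V.

End Cotorsion.

Section TriangularClasses.
Variables (R S : pzRingType) (M : bimodType R S).

(* A condition on triples, read as a class of modules over the triangular ring
   through the identification of (X, Y, phi) with tri_mod. *)
Definition tri_class (Q : triple M -> Prop) : modclass (tri_ring M) :=
  fun V => exists T : triple M, Q T /\ lmod_iso (tri_mod T) V.

Definition col_class (P : modclass R) (Q : modclass S) : modclass (tri_ring M) :=
  tri_class (fun T => P (fstc T) /\ Q (sndc T)).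

Definition B_class (X : modclass R) (Y : modclass S) : modclass (tri_ring M) :=
  tri_class (fun T =>
    [/\ Y (sndc T), is_zero (ker (structmap T)) & X (coker (structmap T))]).

Definition D_class (P : modclass R) (N : modclass S) : modclass (tri_ring M) :=
  tri_class (fun T =>
    [/\ P (fstc T), N (ker (adjoint (structmap T)))
      & is_zero (coker (adjoint (structmap T)))]).

End TriangularClasses.

Arguments col_class {R S} M P Q.
Arguments B_class {R S} M X Y.
Arguments D_class {R S} M P N.

(* Main.v *)
Require Import Defs.
From HB Require Import structures.
From mathcomp Require Import all_boot all_algebra.
From mathcomp Require Import boolp.

(** A module over the triangular ring is a triple [(X, Y)] with a structure map
    from [M (x) Y] to [X], and the two components are exact functors; both
    halves of the theorem reduce Ext over the triangular ring to Ext of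
    components, and build approximations from those of the components.

    Vanishing of Ext.  In a triple [D = (Z, N)] of the class D, the map
    [N -> Hom (M, Z)] is onto with kernel [K] in the class N, so that [D] is an
    extension of [(Z, Hom (M, Z))] by [(0, K)].  These are the values of the
    right adjoints of the two components, so Ext from [(X, Y)] is controlled by
    Ext from [X] to [Z] and from [Y] to [K].  The second component preserves
    projectives; the first turns free modules into direct sums of copies
    of [R] and [M], which Ext into [Z] does not distinguish from projectives in
    degrees up to [n] ([ext_vanish_epi_adjoint]).  Dually, a triple of the
    class B is an extension of [(C, 0)], where [C] is the cokernel of the
    structure map, by [(M (x) Y, Y)], and these are the values of the left
    adjoints; [Y |-> (M (x) Y, Y)] is exact enough on a projective resolution
    of [Y] because Tor vanishes up to degree [n]
    ([ext_vanish_mono_structmap]).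

    Approximations.  A triple [(A1, A2)] is covered by some [(X, Y)], where [X]
    covers [A1] and [Y] covers the pullback of [A2] and [Hom (M, X)] over
    [Hom (M, A1)]; the kernel is an extension of [(M', Hom (M, M'))] by
    [(0, N')], with [M'] and [N'] the kernels of the two covers
    ([left_approximation]).  Vanishing of Ext from [M] makes
    [Z |-> (Z, Hom (M, Z))] exact on the finite resolution of [M'], so both ends
    have finite resolutions by the class D ([D_resolved_hom],
    [D_resolved_snd]), and so has the kernel by the closure under extensions.
    The construction for the right pair is dual, with the pushout of [A1] and
    [M (x) W] ([right_approximation], [B_coresolved_tensor]).

    Ext and Tor in positive degree are treated together: vanishing is tested on
    syzygies, down to degree 1, where it becomes a condition on the inclusion
    of a syzygy in a projective module.  The parts of the long exact sequences
    that are needed follow from four elementary properties of that condition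
    ([admissible], [lesP]). *)

Set Implicit Arguments.
Unset Strict Implicit.
Unset Printing Implicit Defensive.

Import GRing.Theory.

Local Open Scope ring_scope.

(** * Linear maps and short exact sequences *)

Section MakeLinear.
Variables (R : pzRingType) (U V : lmodType R) (f : U -> V) (lin_f : linear f).

Definition linear_fun : U -> V := f.
HB.instance Definition _ := GRing.isLinear.Build R U V *:%R linear_fun lin_f.

Definition mk_linear : {linear U -> V} := linear_fun.

Lemma mk_linearE u : mk_linear u = f u.
Proof. by []. Qed.

End MakeLinear.

Section Factor.
Variable R : pzRingType.
Implicit Types U V W A K P : lmodType R.

Lemma mono_ker0 U V (f : {linear U -> V}) :
  (forall u, f u = 0 -> u = 0) -> mono f.
Proof.
by move=> f0 u v fuv; apply/eqP; rewrite -subr_eq0; apply/eqP/f0;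
  rewrite linearB /= fuv subrr.
Qed.

Lemma mono_eq0 U V (f : {linear U -> V}) u : mono f -> f u = 0 -> u = 0.
Proof. by move=> fm fu0; apply: fm; rewrite fu0 linear0. Qed.

Lemma factor_epi U V W (q : {linear U -> V}) (h : {linear U -> W}) :
    epi q -> (forall u, q u = 0 -> h u = 0) ->
  exists g : {linear V -> W}, forall u, g (q u) = h u.
Proof.
move=> /choice[s qs] hq.
have hs u : h (s (q u)) = h u.
  by apply/eqP; rewrite -subr_eq0 -linearB; apply/eqP/hq; rewrite linearB /= qs subrr.
have gl : linear (h \o s).
  by move=> a x y /=; rewrite -linearP -[RHS]hs linearP /= !qs.
by exists (mk_linear gl).
Qed.

Lemma factor_mono U V W (f : {linear U -> V}) (h : {linear W -> V}) :
    mono f -> (forall w, exists u, f u = h w) ->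
  exists g : {linear W -> U}, forall w, f (g w) = h w.
Proof.
move=> fm /choice[g fg].
have gl : linear g by move=> a x y; apply: fm; rewrite linearP !fg linearP.
by exists (mk_linear gl).
Qed.

Lemma val_ker U V (f : {linear U -> V}) (x : ker f) : f (val x) = 0.
Proof. exact/eqP/(valP x). Qed.

Lemma kerP U V (f : {linear U -> V}) u : f u = 0 -> exists x : ker f, val x = u.
Proof. by move=> fu; exists (exist _ u (introT eqP fu)). Qed.

Lemma ker_zeroP U V (f : {linear U -> V}) : is_zero (ker f) <-> mono f.
Proof.
split=> [k0|fm x].
  by apply: mono_ker0 => u /kerP[x <-]; rewrite (k0 x) linear0.
by apply: val_inj; rewrite (mono_eq0 fm (val_ker x)) linear0.
Qed.

Lemma ses_ker U V (f : {linear U -> V}) : epi f ->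
  short_exact (val : {linear ker f -> U}) f.
Proof.
move=> fe; split=> [|v|//]; first exact: val_inj.
by split=> [/kerP //|[x <-]]; exact: val_ker.
Qed.

Lemma coker_proj_epi U V (f : {linear U -> V}) : epi (coker_proj f).
Proof. by move=> c; exists (repr c); rewrite coker_projK. Qed.

Lemma coker_proj_eq0 U V (f : {linear U -> V}) v :
  coker_proj f v = 0 <-> exists u, f u = v.
Proof. by rewrite -(linear0 (coker_proj f)) coker_proj_eq subr0. Qed.

Lemma ses_coker U V (f : {linear U -> V}) : mono f ->
  short_exact f (coker_proj f).
Proof. by move=> fm; split=> // [v|]; [exact: coker_proj_eq0|exact: coker_proj_epi]. Qed.

Lemma coker_zeroP U V (f : {linear U -> V}) : is_zero (coker f) <-> epi f.
Proof.
split=> [c0 v|fe c]; first exact/coker_proj_eq0/c0.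
by have [v <-] := coker_proj_epi c; exact/coker_proj_eq0/fe.
Qed.

Lemma lmod_iso_refl U : lmod_iso U U.
Proof. by exists idfun; split=> // u; exists u. Qed.

Lemma lmod_iso_sym U V : lmod_iso U V -> lmod_iso V U.
Proof.
move=> [f [fm fe]]; have [|g fg] := @factor_mono _ _ _ f idfun fm.
  exact: fe.
exists g; split=> [x y /(congr1 f)|u]; first by rewrite !fg.
by exists (f u); apply: fm; rewrite fg.
Qed.

Lemma lmod_iso_trans U V W : lmod_iso U V -> lmod_iso V W -> lmod_iso U W.
Proof.
move=> [f [fm fe]] [g [gm ge]]; exists (g \o f); split=> [x y /gm/fm //|w].
by have [v <-] := ge w; have [u <-] := fe v; exists u.
Qed.

Lemma ses_isor K P A A' (i : {linear K -> P}) (p : {linear P -> A})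
    (f : {linear A -> A'}) :
  mono f -> epi f -> short_exact i p -> short_exact i (f \o p).
Proof.
move=> fm fe [im ex pe]; split=> // [v|a].
  by rewrite -ex /=; split=> [/(mono_eq0 fm)//|->]; rewrite linear0.
by have [b <-] := fe a; have [v <-] := pe b; exists v.
Qed.

Lemma ses_comp0 K P A (i : {linear K -> P}) (p : {linear P -> A}) k :
  short_exact i p -> p (i k) = 0.
Proof. by move=> [_ ex _]; apply/ex; exists k. Qed.

Lemma projective_iso P P' : lmod_iso P P' -> projective P -> projective P'.
Proof.
move=> [f [fm fe]] Pproj U V g h ge.
have [k gk] := Pproj U V g (h \o f) ge.
have [|l kl] := @factor_epi P P' U f k fe.
  by move=> u /(mono_eq0 fm)->; rewrite linear0.
by exists l => x; have [u <-] := fe x; rewrite kl gk.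
Qed.

Definition zero_mod : lmodType R := ker (idfun : {linear R^o -> R^o}).

Lemma zero_mod0 : is_zero zero_mod.
Proof. by apply/ker_zeroP => x y. Qed.

Definition zero_map U V : {linear U -> V} := \0.

End Factor.

(** * Direct sums and free modules *)

Section DirectSum.
Variables (R : pzRingType) (I : choiceType) (A : lmodType R).

Record dsum : Type := Dsum {
  dsum_fun :> I -> A;
  dsum_fin : exists s : seq I, forall i, i \notin s -> dsum_fun i = 0
}.

Lemma dsum_eq (x y : dsum) : x =1 y -> x = y.
Proof.
case: x y => [f ff] [g gf] /= /funext fg; case: _ / fg in gf *.
by rewrite (Prop_irrelevance ff gf).
Qed.

HB.instance Definition _ := gen_eqMixin dsum.
HB.instance Definition _ := gen_choiceMixin dsum.

Fact dsum_zero_fin : exists s : seq I, forall i, i \notin s -> (0 : A) = 0.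
Proof. by exists [::]. Qed.
Definition dsum_zero : dsum := Dsum dsum_zero_fin.

Fact dsum_opp_fin (x : dsum) :
  exists s : seq I, forall i, i \notin s -> - x i = 0.
Proof. by have [s xs] := dsum_fin x; exists s => i /xs->; rewrite oppr0. Qed.
Definition dsum_opp x : dsum := Dsum (dsum_opp_fin x).

Fact dsum_add_fin (x y : dsum) :
  exists s : seq I, forall i, i \notin s -> x i + y i = 0.
Proof.
have [s xs] := dsum_fin x; have [t yt] := dsum_fin y; exists (s ++ t) => i.
by rewrite mem_cat negb_or => /andP[/xs-> /yt->]; rewrite addr0.
Qed.
Definition dsum_add x y : dsum := Dsum (dsum_add_fin x y).

Fact dsum_addA : associative dsum_add.
Proof. by move=> x y z; apply: dsum_eq => i /=; exact: addrA. Qed.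
Fact dsum_addC : commutative dsum_add.
Proof. by move=> x y; apply: dsum_eq => i /=; exact: addrC. Qed.
Fact dsum_add0 : left_id dsum_zero dsum_add.
Proof. by move=> x; apply: dsum_eq => i /=; exact: add0r. Qed.
Fact dsum_addN : left_inverse dsum_zero dsum_opp dsum_add.
Proof. by move=> x; apply: dsum_eq => i /=; exact: addNr. Qed.

HB.instance Definition _ := GRing.isZmodule.Build dsum
  dsum_addA dsum_addC dsum_add0 dsum_addN.

Fact dsum_scale_fin (a : R) (x : dsum) :
  exists s : seq I, forall i, i \notin s -> a *: x i = 0.
Proof. by have [s xs] := dsum_fin x; exists s => i /xs->; rewrite scaler0. Qed.
Definition dsum_scale a x : dsum := Dsum (dsum_scale_fin a x).

Fact dsum_scalerA a b x : dsum_scale a (dsum_scale b x) = dsum_scale (a * b) x.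
Proof. by apply: dsum_eq => i /=; rewrite scalerA. Qed.
Fact dsum_scale1r : left_id 1 dsum_scale.
Proof. by move=> x; apply: dsum_eq => i /=; rewrite scale1r. Qed.
Fact dsum_scalerDr : right_distributive dsum_scale +%R.
Proof. by move=> a x y; apply: dsum_eq => i /=; rewrite scalerDr. Qed.
Fact dsum_scalerDl x : {morph dsum_scale^~ x : a b / a + b}.
Proof. by move=> a b; apply: dsum_eq => i /=; rewrite scalerDl. Qed.

HB.instance Definition _ := GRing.Zmodule_isLmodule.Build R dsum
  dsum_scalerA dsum_scale1r dsum_scalerDr dsum_scalerDl.

Definition dsum_coord (i : I) (x : dsum) : A := x i.
Fact dsum_coord_linear i : linear (dsum_coord i).
Proof. by []. Qed.
HB.instance Definition _ i :=
  GRing.isLinear.Build R dsum A *:%R (dsum_coord i) (dsum_coord_linear i).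

Fact single_fin (i : I) (a : A) :
  exists s : seq I, forall j, j \notin s -> (if j == i then a else 0) = 0.
Proof. by exists [:: i] => j; rewrite inE => /negPf->. Qed.
Definition single i a : dsum := Dsum (single_fin i a).

Lemma single_linear i : linear (single i).
Proof.
move=> c a b; apply: dsum_eq => j.
rewrite -[RHS]/(c *: single i a j + single i b j) /=.
by case: ifP => // _; rewrite scaler0 addr0.
Qed.

Lemma dsum_decomp (x : dsum) :
  exists2 s : seq I, uniq s & forall t, uniq t -> {subset s <= t} ->
    x = \sum_(i <- t) single i (x i).
Proof.
have [s xs] := dsum_fin x; exists (undup s); first exact: undup_uniq.
move=> t tu st; apply: dsum_eq => j.
rewrite -[RHS]/(dsum_coord j _) linear_sum /=.
have [jt|jt] := boolP (j \in t).
  rewrite (bigD1_seq j) //= /dsum_coord /= eqxx big1 ?addr0 // => i.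
  by rewrite eq_sym => /negPf->.
rewrite big_seq big1 => [|i it].
  by apply: xs; apply: contra jt; rewrite -mem_undup => /st.
by rewrite /dsum_coord /=; case: eqP => // ji; rewrite ji it in jt.
Qed.

Variable V : lmodType R.

Lemma dsum_ext (f g : {linear dsum -> V}) :
  (forall i a, f (single i a) = g (single i a)) -> f =1 g.
Proof.
move=> fg x; have [s su xE] := dsum_decomp x.
by rewrite (xE s su (fun _ => id)) !linear_sum; apply: eq_bigr => i _.
Qed.

Lemma dsum_lift (h : I -> {linear A -> V}) :
  exists g : {linear dsum -> V}, forall i a, g (single i a) = h i a.
Proof.
have /choice[s xs] : forall x : dsum, exists s, uniq s /\
    forall i, i \notin s -> x i = 0.
  move=> x; have [s xs] := dsum_fin x; exists (undup s).
  by split=> [|i]; rewrite ?undup_uniq // mem_undup => /xs.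
pose g (x : dsum) := \sum_(i <- s x) h i (x i).
have gE (x : dsum) t : uniq t -> (forall i, i \notin t -> x i = 0) ->
    g x = \sum_(i <- t) h i (x i).
  have [su sx] := xs x => tu tx.
  have widen (r r' : seq I) : uniq r -> uniq r' ->
      (forall i, i \notin r -> x i = 0) -> {subset r <= r'} ->
      \sum_(i <- r') h i (x i) = \sum_(i <- r) h i (x i).
    move=> ru r'u rx rr'; rewrite (bigID (mem r)) /= addrC big1 => [|i /rx->].
      rewrite add0r -big_filter; apply: perm_big; apply: uniq_perm => //.
        exact: filter_uniq.
      by move=> i; rewrite mem_filter andbC; case: (boolP (i \in r')) => //= /negP ir';
        apply/esym/negP => /rr'.
    by rewrite linear0.
  rewrite -(widen _ (undup (s x ++ t))) ?undup_uniq //; last first.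
    by move=> i it; rewrite mem_undup mem_cat it orbT.
  apply/esym/widen; rewrite ?undup_uniq //.
  by move=> i si; rewrite mem_undup mem_cat si.
have gl : linear g.
  move=> c x y; pose t := undup (s (c *: x + y) ++ s x ++ s y).
  have [tu tc tx ty] : [/\ uniq t, forall i, i \notin t -> (c *: x + y) i = 0,
      forall i, i \notin t -> x i = 0 & forall i, i \notin t -> y i = 0].
    by split=> [|i|i|i]; rewrite ?undup_uniq // mem_undup !mem_cat !negb_or
      => /and3P[i1 i2 i3]; [have [_] := xs (c *: x + y)|have [_] := xs x
      |have [_] := xs y]; apply.
  rewrite (gE _ t) // (gE x t) // (gE y t) // scaler_sumr -big_split /=.
  by apply: eq_bigr => i _; rewrite -linearP.
exists (mk_linear gl) => i a; rewrite mk_linearE (gE _ [:: i]) //.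
  by rewrite big_seq1 /= eqxx.
by move=> j; rewrite inE /= => /negPf->.
Qed.

End DirectSum.

Section DirectSumMaps.
Variables (R : pzRingType) (I : choiceType).
Implicit Types A B C P : lmodType R.

Fact dsum_map_fin A B (f : {linear A -> B}) (x : dsum I A) :
  exists s : seq I, forall i, i \notin s -> f (x i) = 0.
Proof. by have [s xs] := dsum_fin x; exists s => i /xs->; rewrite linear0. Qed.
Definition dsum_map A B (f : {linear A -> B}) (x : dsum I A) : dsum I B :=
  Dsum (dsum_map_fin f x).

Fact dsum_map_linear A B (f : {linear A -> B}) : linear (dsum_map f).
Proof. by move=> c x y; apply: dsum_eq => i /=; exact: linearP. Qed.
HB.instance Definition _ A B (f : {linear A -> B}) :=
  GRing.isLinear.Build R (dsum I A) (dsum I B) *:%R (dsum_map f)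
    (dsum_map_linear f).

Lemma dsum_map_single A B (f : {linear A -> B}) i a :
  dsum_map f (single i a) = single i (f a).
Proof.
by apply: dsum_eq => j /=; case: ifP => // _; rewrite linear0.
Qed.

Lemma dsum_map_preim A B (f : {linear A -> B}) (y : dsum I B) :
  (forall i, exists a, f a = y i) -> exists x, dsum_map f x = y.
Proof.
move=> fy; have [s ys] := dsum_fin y.
have /choice[x fx] : forall i, exists a, f a = y i /\ (i \notin s -> a = 0).
  move=> i; case: (boolP (i \in s)) => [_|/ys yi]; last first.
    by exists 0; rewrite linear0 yi.
  by have [a fa] := fy i; exists a.
have xfin : exists s : seq I, forall i, i \notin s -> x i = 0.
  by exists s => i; have [_] := fx i.
by exists (Dsum xfin); apply: dsum_eq => i /=; have [] := fx i.
Qed.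

Lemma dsum_ses A B C (f : {linear A -> B}) (g : {linear B -> C}) :
  short_exact f g -> short_exact (dsum_map f) (dsum_map g).
Proof.
move=> fg; have [fm ex ge] := fg; split.
- by move=> x y xy; apply: dsum_eq => i; apply: fm; exact: (congr1 (dsum_coord i) xy).
- move=> y; split=> [gy|[x <-]].
    by apply: dsum_map_preim => i; apply/ex; exact: (congr1 (dsum_coord i) gy).
  by apply: dsum_eq => i /=; rewrite (ses_comp0 _ fg).
- by move=> z; apply: dsum_map_preim => i; exact: ge.
Qed.

(** Maps out of a direct sum are families of maps, lifted one by one. *)
Lemma dsum_projective P : projective P -> projective (dsum I P).
Proof.
move=> Pproj U V g f ge.
have /choice[h gh] : forall i, exists h : {linear P -> U},
    forall x, g (h x) = f (single i x).
  by move=> i; exact: (Pproj U V g (f \o mk_linear (single_linear i)) ge).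
have [k kh] := dsum_lift h; exists k => x.
by rewrite -[LHS]/((g \o k) x); apply: dsum_ext => i a /=; rewrite kh gh.
Qed.

End DirectSumMaps.

Section Free.
Variable R : pzRingType.

Lemma regular_projective : projective (R^o : lmodType R).
Proof.
move=> U V g f ge; have [u gu] := ge (f 1).
have hl : linear (fun r : R^o => (r : R) *: u).
  by move=> a x y; rewrite scalerDl scalerA.
by exists (mk_linear hl) => x; rewrite mk_linearE linearZ /= gu -linearZ /= /GRing.scale /= mulr1.
Qed.

Lemma free_projective (I : choiceType) : projective (dsum I R^o).
Proof. exact/dsum_projective/regular_projective. Qed.

Lemma free_cover (A : lmodType R) : exists p : {linear dsum A R^o -> A}, epi p.
Proof.
have hl (a : A) : linear (fun r : R^o => (r : R) *: a).
  by move=> c x y; rewrite scalerDl scalerA.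
have [p pE] := dsum_lift (fun a => mk_linear (hl a)).
by exists p => a; exists (single a (1 : R^o)); rewrite pE mk_linearE scale1r.
Qed.

Lemma presentation (A : lmodType R) : exists (K P : lmodType R)
  (i : {linear K -> P}) (p : {linear P -> A}), short_exact i p /\ projective P.
Proof.
have [p pe] := free_cover A; exists (ker p), (dsum A R^o), val, p.
by split; [exact: ses_ker|exact: free_projective].
Qed.

End Free.

(** * Dimension shifting *)

Section Diagrams.
Variable R : pzRingType.
Implicit Types K P A L Q F : lmodType R.

Lemma pullback P Q A (p : {linear P -> A}) (q : {linear Q -> A}) :
  exists (E : lmodType R) (a : {linear E -> P}) (b : {linear E -> Q}),
    [/\ forall e, p (a e) = q (b e),
        forall x y, p x = q y -> exists e, a e = x /\ b e = y &
        forall e e', a e = a e' -> b e = b e' -> e = e'].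
Proof.
pose d : {linear (P * Q)%type -> A} := (p \o fst) \- (q \o snd).
have dE x : d x = p x.1 - q x.2 by [].
exists (ker d), (fst \o val), (snd \o val); split=> [e|x y xy|e e' /= a b].
- by apply/eqP; rewrite -subr_eq0 -dE val_ker.
- have [|e ev] := @kerP _ _ _ d (x, y); first by rewrite dE /= xy subrr.
  by exists e; rewrite /= ev.
- apply: val_inj.
  have pairP (w w' : (P * Q)%type) : w.1 = w'.1 -> w.2 = w'.2 -> w = w'.
    by case: w w' => x y [x' y'] /= -> ->.
  exact: pairP a b.
Qed.

Lemma pullback_kernel K P Q A (E : lmodType R) (i : {linear K -> P}) (p : {linear P -> A})
    (q : {linear Q -> A}) (a : {linear E -> P}) (b : {linear E -> Q}) :
    short_exact i p -> (forall e, p (a e) = q (b e)) ->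
    (forall x y, p x = q y -> exists e, a e = x /\ b e = y) ->
    (forall e e', a e = a e' -> b e = b e' -> e = e') ->
  exists k' : {linear K -> E}, short_exact k' b /\ forall k, a (k' k) = i k.
Proof.
move=> ip pq mk ab; have [im ex pe] := ip.
have /choice[k' k'E] : forall k, exists e, a e = i k /\ b e = 0.
  by move=> k; apply: mk; rewrite (ses_comp0 _ ip) linear0.
have k'l : linear k'.
  move=> c x y; have [a1 b1] := k'E x; have [a2 b2] := k'E y.
  have [a3 b3] := k'E (c *: x + y).
  by apply: ab; rewrite linearP ?a1 ?a2 ?a3 ?b1 ?b2 ?b3 ?linearP // scaler0 addr0.
exists (mk_linear k'l); split; last by move=> k; have [] := k'E k.
split=> [x y|e|y].
- rewrite !mk_linearE => xy; apply: im.
  by have [<- _] := k'E x; have [<- _] := k'E y; rewrite xy.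
- split=> [be|[k <-]]; last by have [] := k'E k.
  have [k ik] : exists k, i k = a e by apply/ex; rewrite pq be linear0.
  by have [ak bk] := k'E k; exists k; apply: ab; rewrite mk_linearE ?ak ?bk.
- by have [x px] := pe (q y); have [e [_ <-]] := mk x y px; exists e.
Qed.

Lemma pullback_ses K P A L Q (i : {linear K -> P}) (p : {linear P -> A})
    (l : {linear L -> Q}) (q : {linear Q -> A}) :
    short_exact i p -> short_exact l q ->
  exists (E : lmodType R) (a : {linear E -> P}) (b : {linear E -> Q})
    (k' : {linear K -> E}) (l' : {linear L -> E}),
    [/\ forall e, p (a e) = q (b e), short_exact l' a, short_exact k' b,
        forall k, a (k' k) = i k & forall x, b (l' x) = l x].
Proof.
move=> ip lq; have [E [a [b [ab mk inj]]]] := pullback p q.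
have [k' [k'b k'a]] := pullback_kernel ip ab mk inj.
have [||l' [l'a l'b]] := pullback_kernel lq (fun e => esym (ab e)).
- by move=> y x yx; have [e []] := mk x y (esym yx); exists e.
- by move=> e e' be ae; apply: inj.
by exists E, a, b, k', l'; split.
Qed.

(** The kernel [A'] of a composite of epimorphisms [F -> P -> A] is an
    extension of the kernel [K] of the second by the kernel [L] of the first.
    When [F] is projective, [L] and [A'] are syzygies of [P] and [A], so this
    trades a question on [K] in one degree for questions on [P] and [A]
    in the next, as a connecting map would. *)
Lemma rotate_ses K P A L F (i : {linear K -> P}) (p : {linear P -> A})
    (l : {linear L -> F}) (q : {linear F -> P}) :
    short_exact i p -> short_exact l q ->
  exists (A' : lmodType R) (v : {linear A' -> F}) (l' : {linear L -> A'})
    (q' : {linear A' -> K}),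
    [/\ short_exact v (p \o q), short_exact l' q',
        forall x, v (l' x) = l x & forall x, i (q' x) = q (v x)].
Proof.
move=> ip lq; have [im ex pe] := ip; have [lm exl qe] := lq.
have pqe : epi (p \o q).
  by move=> a; have [x <-] := pe a; have [y <-] := qe x; exists y.
have [A' [v vs]] : exists (A' : lmodType R) (v : {linear A' -> F}),
    short_exact v (p \o q) by exists (ker (p \o q)), val; exact: ses_ker.
have [vm exv _] := vs.
have [|l' l'E] := @factor_mono _ _ _ _ v l vm.
  by move=> x; apply/exv; rewrite /= (ses_comp0 _ lq) linear0.
have [|q' q'E] := @factor_mono _ _ _ _ i (q \o v) im.
  by move=> x; apply/ex; exact: (ses_comp0 x vs).
exists A', v, l', q'; split=> //; split.
- by move=> x y xy; apply: lm; rewrite -!l'E xy.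
- move=> x; split=> [q'x|[y <-]].
    have [|y ly] := (exl (v x)).1; first by rewrite -[LHS]q'E q'x linear0.
    by exists y; apply: vm; rewrite l'E.
  by apply: im; rewrite q'E /= l'E linear0 (ses_comp0 _ lq).
- move=> k; have [y qy] := qe (i k).
  have [|x vx] := (exv y).1; first by rewrite /= qy (ses_comp0 _ ip).
  by exists x; apply: im; rewrite q'E /= vx.
Qed.

End Diagrams.

Definition linpred (R : pzRingType) : Type :=
  forall U V : lmodType R, {linear U -> V} -> Prop.

(** A predicate on linear maps [K -> P] that decides the first-degree vanishing
    for a cokernel of [K -> P] with [P] projective: for Ext into [Z] it says
    that maps to [Z] extend along [K -> P], for Tor that [K -> P] remains
    injective after tensoring.  The four conditions are all that the long
    exact sequences below depend on. *)
Record admissible (R : pzRingType)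
    (G : linpred R) : Prop := Admissible {
  adm_split : forall (U V : lmodType R) (f : {linear U -> V}) (r : {linear V -> U}),
    (forall u, r (f u) = u) -> G _ _ f;
  adm_factor : forall (U V W : lmodType R) (f : {linear U -> V}) (g : {linear V -> W})
      (h : {linear U -> W}),
    (forall u, h u = g (f u)) -> G _ _ h -> G _ _ f;
  adm_comp : forall (U V W : lmodType R) (f : {linear U -> V}) (g : {linear V -> W})
      (h : {linear U -> W}),
    (forall u, h u = g (f u)) -> G _ _ f -> G _ _ g -> G _ _ h;
  adm_transfer : forall (E K K' P P' : lmodType R) (k : {linear K -> E}) (p : {linear E -> P})
      (k' : {linear K' -> E}) (p' : {linear E -> P'})
      (u : {linear K' -> P}) (u' : {linear K -> P'}),
    short_exact k p -> short_exact k' p' ->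
    (forall x, p (k' x) = u x) -> (forall x, p' (k x) = u' x) ->
    G _ _ k -> G _ _ u -> G _ _ u'
}.
Arguments adm_split {R G} _ {U V f}.
Arguments adm_factor {R G} _ {U V W f}.
Arguments adm_comp {R G} _ {U V W}.
Arguments adm_transfer {R G} _ {E K K' P P' k p k' p' u u'}.

Section Vanishing.
Variables (R : pzRingType) (G : linpred R).
Implicit Types K P A L Q F E : lmodType R.

(** Vanishing in degree [j + 1], tested on all syzygies of [A]. *)
Fixpoint vanish (j : nat) (A : lmodType R) : Prop :=
  forall (K P : lmodType R) (i : {linear K -> P}) (p : {linear P -> A}),
    short_exact i p -> projective P ->
    if j is j'.+1 then vanish j' K else G i.

Hypothesis Gadm : admissible G.

Lemma vanish_iso j A A' : lmod_iso A A' -> vanish j A -> vanish j A'.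
Proof.
move=> /lmod_iso_sym[f [fm fe]]; case: j => [|j] vA K P i p ip Pproj;
  exact: (vA _ _ _ _ (ses_isor fm fe ip)).
Qed.

(** On the pullback [W] of [P] and [P'] over [A], the map [g] splits the
    projection to [P]; the transfer condition is then applied to the two exact
    sequences [K -> P] and [K' -> W] that [W] carries. *)
Lemma adm_morph K P A K' P' (k : {linear K -> P}) (p : {linear P -> A})
    (k' : {linear K' -> P'}) (p' : {linear P' -> A}) (g : {linear P -> P'}) :
    short_exact k p -> short_exact k' p' -> (forall x, p' (g x) = p x) ->
  G k -> G k'.
Proof.
move=> kp kp' pg Gk; have [km' ex' _] := kp'.
have [W [a [b [kW [kW' [ab s1 s2 akW bkW]]]]]] := pullback_ses kp kp'.
pose d : {linear W -> P'} := b \- (g \o a).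
have [|r rE] := @factor_mono _ _ _ _ k' d km'.
  by move=> w; apply/ex'; rewrite linearB /= pg ab subrr.
apply: (adm_transfer Gadm s1 s2 akW bkW) => //.
apply: (adm_split Gadm r) => x; apply: km'.
by rewrite rE /= bkW (ses_comp0 _ s1) linear0 subr0.
Qed.

(** Every extension of [A], with projective middle term or not, receives
    a morphism from a projective presentation of [A]. *)
Lemma vanish0_ses K E A (k : {linear K -> E}) (p : {linear E -> A}) :
  short_exact k p -> vanish 0 A -> G k.
Proof.
move=> kp vA; have [L [F [l [q [lq Fproj]]]]] := presentation A.
have [_ _ pe] := kp; have [g pg] := Fproj _ _ p q pe.
exact: (adm_morph lq kp pg (vA _ _ _ _ lq Fproj)).
Qed.

Lemma vanish0_quotient K P A (i : {linear K -> P}) (p : {linear P -> A}) :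
  short_exact i p -> G i -> vanish 0 P -> vanish 0 A.
Proof.
move=> ip Gi vP K' P' i' p' ip' _.
have [W [a [b [kW [kW' [ab s1 s2 akW bkW]]]]]] := pullback_ses ip ip'.
exact: (adm_transfer Gadm s1 s2 akW bkW (vanish0_ses s1 vP) Gi).
Qed.

Lemma vanish0_ext K P A (i : {linear K -> P}) (p : {linear P -> A}) :
  short_exact i p -> vanish 0 K -> vanish 0 A -> vanish 0 P.
Proof.
move=> ip vK vA L F l q lq Fproj.
have [A' [v [l' [q' [s1 s2 vl' _]]]]] := rotate_ses ip lq.
exact: (adm_comp Gadm _ _ _ (fun x => esym (vl' x)) (vanish0_ses s2 vK)
  (vanish0_ses s1 vA)).
Qed.

Lemma vanish0_sub K P A (i : {linear K -> P}) (p : {linear P -> A}) :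
  short_exact i p -> vanish 0 P -> vanish 1 A -> vanish 0 K.
Proof.
move=> ip vP vA; have [L [F [l [q [lq Fproj]]]]] := presentation P.
have [A' [v [l' [q' [s1 s2 vl' _]]]]] := rotate_ses ip lq.
apply: (vanish0_quotient s2); last exact: vA s1 Fproj.
exact: (adm_factor Gadm _ _ (fun x => esym (vl' x)) (vP _ _ _ _ lq Fproj)).
Qed.

Lemma ses_retraction K Q P (i : {linear K -> Q}) (p : {linear Q -> P}) :
  short_exact i p -> projective P ->
  exists r : {linear Q -> K}, forall k, r (i k) = k.
Proof.
move=> ip Pproj; have [im ex pe] := ip.
have [s ps] := Pproj _ _ p idfun pe.
pose d : {linear Q -> Q} := idfun \- (s \o p).
have [|r rE] := @factor_mono _ _ _ _ i d im.
  by move=> x; apply/ex; rewrite linearB /= ps subrr.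
by exists r => k; apply: im; rewrite rE /= (ses_comp0 _ ip) linear0 subr0.
Qed.

Lemma projective_retract Q K (i : {linear K -> Q}) (r : {linear Q -> K}) :
  (forall k, r (i k) = k) -> projective Q -> projective K.
Proof.
move=> ri Qproj U V g f ge; have [h gh] := Qproj U V g (f \o r) ge.
by exists (h \o i) => x; rewrite /= gh /= ri.
Qed.

Lemma vanish_projective j P : projective P -> vanish j P.
Proof.
elim: j P => [|j IHj] P Pproj K Q i p ip Qproj;
  have [r ri] := ses_retraction ip Pproj.
  exact: (adm_split Gadm r).
by apply: IHj; exact: projective_retract ri Qproj.
Qed.

(** Two of the three exactness statements of the long exact sequence in degrees
    [j + 1] and [j + 2].  The third, [lesS_quotient], concludes in degree
    [j + 2] and follows from these. *)
Definition les j : Prop := forall K P A (i : {linear K -> P}) (p : {linear P -> A}),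
  short_exact i p ->
  [/\ vanish j P -> vanish j.+1 A -> vanish j K &
      vanish j K -> vanish j A -> vanish j P].

(** Two projective presentations [K -> P -> A] and [K' -> P' -> A] are compared
    on the pullback of [P] and [P'] over [A], an extension of a projective
    by each of [K] and [K']. *)
Lemma les_syzygy j : les j ->
  forall K P K' P' A (i : {linear K -> P}) (p : {linear P -> A})
    (i' : {linear K' -> P'}) (p' : {linear P' -> A}),
  short_exact i p -> short_exact i' p' -> projective P -> projective P' ->
  vanish j K -> vanish j K'.
Proof.
move=> lesj K P K' P' A i p i' p' ip ip' Pproj P'proj vK.
have [W [a [b [kW [kW' [_ s1 s2 _ _]]]]]] := pullback_ses ip ip'.
have [sub _] := lesj _ _ _ _ _ s1; have [_ ext] := lesj _ _ _ _ _ s2.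
by apply: sub (vanish_projective _ Pproj); exact: ext (vanish_projective _ P'proj).
Qed.

Lemma lesS_quotient j : les j ->
  forall K P A (i : {linear K -> P}) (p : {linear P -> A}),
  short_exact i p -> vanish j K -> vanish j.+1 P -> vanish j.+1 A.
Proof.
move=> lesj K P A i p ip vK vP K' P' i' p' ip' P'proj.
have [L [F [l [q [lq Fproj]]]]] := presentation P.
have [A' [v [l' [q' [s1 s2 _ _]]]]] := rotate_ses ip lq.
apply: (les_syzygy lesj s1 ip' Fproj P'proj).
by have [_] := lesj _ _ _ _ _ s2; apply=> //; exact: vP lq Fproj.
Qed.

(** A short exact sequence [K -> P -> A] and an epimorphism [F -> P] from
    a projective give
    the sequence [L -> A' -> K] of [rotate_ses], where [L] and [A'] are
    syzygies of [P] and [A].  Each statement about [K -> P -> A] is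
    a different statement about [L -> A' -> K], one degree lower on [P] and
    [A], so that the three statements carry each other along an induction. *)
Lemma lesP j : les j.
Proof.
elim: j => [|j IHj] K P A i p ip; split.
- exact: vanish0_sub ip.
- exact: vanish0_ext ip.
- move=> vP vA; have [L [F [l [q [lq Fproj]]]]] := presentation P.
  have [A' [v [l' [q' [s1 s2 _ _]]]]] := rotate_ses ip lq.
  apply: (lesS_quotient IHj s2); first exact: vP lq Fproj.
  exact: vA s1 Fproj.
- move=> vK vA L F l q lq Fproj.
  have [A' [v [l' [q' [s1 s2 _ _]]]]] := rotate_ses ip lq.
  by have [sub _] := IHj _ _ _ _ _ s2; apply: sub vK; exact: vA s1 Fproj.
Qed.

Lemma vanish_sub j K P A (i : {linear K -> P}) (p : {linear P -> A}) :
  short_exact i p -> vanish j P -> vanish j.+1 A -> vanish j K.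
Proof. by move=> ip; have [] := lesP j ip. Qed.

Lemma vanish_ext j K P A (i : {linear K -> P}) (p : {linear P -> A}) :
  short_exact i p -> vanish j K -> vanish j A -> vanish j P.
Proof. by move=> ip; have [] := lesP j ip. Qed.

Lemma vanish0_intro K P A (i : {linear K -> P}) (p : {linear P -> A}) :
  short_exact i p -> projective P -> G i -> vanish 0 A.
Proof.
by move=> ip Pproj Gi; apply: (vanish0_quotient ip Gi); exact: vanish_projective.
Qed.

Lemma vanishS_intro j K P A (i : {linear K -> P}) (p : {linear P -> A}) :
  short_exact i p -> projective P -> vanish j K -> vanish j.+1 A.
Proof.
move=> ip Pproj vK K' P' i' p' ip' P'proj.
exact: (les_syzygy (lesP j) ip ip').
Qed.

End Vanishing.

Arguments res_exact0 {R A} r v.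
Arguments res_exact {R A} r i v.
Arguments cores_exact0 {R A} c v.
Arguments cores_exact {R A} c i v.
Arguments cores_mono {R A} c.

(** * Projective resolutions *)

Section Resolutions.
Variable R : pzRingType.
Implicit Types K P A Z : lmodType R.

Definition res_cons_obj P (Q : nat -> lmodType R) (i : nat) : lmodType R :=
  if i is i'.+1 then Q i' else P.

Section Cons.
Variables (K P A : lmodType R) (i : {linear K -> P}) (p : {linear P -> A}).
Hypothesis ip : short_exact i p.
Variable Q : resolution K.

Definition res_cons_dif (j : nat) :
    {linear res_cons_obj P (res_obj Q) j.+1 -> res_cons_obj P (res_obj Q) j} :=
  match j with
  | 0 => i \o res_aug Q
  | j'.+1 => res_dif Q j'
  end.

Fact res_cons_exact0 : exact_at (res_cons_dif 0) p.
Proof.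
have [_ ex _] := ip; move=> x /=; split=> [/ex[k <-]|[u <-]].
  by have [q <-] := res_epi Q k; exists q.
by rewrite (ses_comp0 _ ip).
Qed.

Fact res_cons_exact j : exact_at (res_cons_dif j.+1) (res_cons_dif j).
Proof.
case: j => [|j] /=; last exact: res_exact.
have [im _ _] := ip; move=> x /=; rewrite -(res_exact0 Q x).
by split=> [/(mono_eq0 im)|->] //; rewrite linear0.
Qed.

Definition res_cons : resolution A :=
  @Resolution R A (res_cons_obj P (res_obj Q)) res_cons_dif p
    (let: And3 _ _ pe := ip in pe) res_cons_exact0 res_cons_exact.

Lemma res_cons_proj :
  projective P -> proj_resolution Q -> proj_resolution res_cons.
Proof. by move=> Pproj Qproj [|j]; [exact: Pproj|exact: Qproj]. Qed.

End Cons.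
Arguments res_cons_proj {K P A i p} ip {Q} _ _.


Section Tail.
Variables (A : lmodType R) (P : resolution A).

Lemma res_tail_aug_ex :
  exists a : {linear res_obj P 1 -> ker (res_aug P)},
    (forall x, val (a x) = res_dif P 0 x) /\ epi a.
Proof.
have vm : mono (val : {linear ker (res_aug P) -> _}) by exact: val_inj.
have [|a aE] := @factor_mono _ _ _ _ _ (res_dif P 0) vm.
  by move=> x; apply: kerP; apply/res_exact0; exists x.
exists a; split=> // k; have [x xk] := (res_exact0 P (val k)).1 (val_ker k).
by exists x; apply: val_inj; rewrite aE.
Qed.

Definition res_tail_aug := projT1 (cid res_tail_aug_ex).
Fact res_tail_augE x : val (res_tail_aug x) = res_dif P 0 x.
Proof. by have [] := projT2 (cid res_tail_aug_ex). Qed.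
Fact res_tail_epi : epi res_tail_aug.
Proof. by have [] := projT2 (cid res_tail_aug_ex). Qed.

Fact res_tail_exact0 : exact_at (res_dif P 1) res_tail_aug.
Proof.
move=> x; rewrite -(res_exact P 0) -res_tail_augE; split=> [->|ax].
  by rewrite linear0.
by apply: val_inj; rewrite ax linear0.
Qed.

Definition res_tail : resolution (ker (res_aug P)) :=
  @Resolution R _ (fun j => res_obj P j.+1) (fun j => res_dif P j.+1)
    res_tail_aug res_tail_epi res_tail_exact0 (fun j => res_exact P j.+1).

End Tail.

Lemma proj_resolution_exists A : exists P : resolution A, proj_resolution P.
Proof.
pose cov (B : lmodType R) := projT1 (cid (free_cover B)).
have cov_epi (B : lmodType R) : epi (cov B) := projT2 (cid (free_cover B)).
pose syz j := iter j (fun B : lmodType R => ker (cov B) : lmodType R) A.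
pose obj j := dsum (syz j) R^o : lmodType R.
pose dif j : {linear obj j.+1 -> obj j} :=
  (val : {linear ker (cov (syz j)) -> _}) \o cov (syz j.+1).
have exact0 j : exact_at (dif j) (cov (syz j)).
  move=> x; split=> [/kerP[k <-]|[y <-]]; last exact: val_ker.
  by have [y <-] := cov_epi _ k; exists y.
have exactS j : exact_at (dif j.+1) (dif j).
  have vm : mono (val : {linear ker (cov (syz j)) -> _}) by exact: val_inj.
  by move=> x; rewrite -exact0; split=> [/(mono_eq0 vm)//|/(congr1 val)].
exists (@Resolution R A obj dif (cov A) (cov_epi A) (exact0 0) exactS) => j.
exact: free_projective.
Qed.

Lemma ses_res_aug A (P : resolution A) :
  short_exact (val : {linear ker (res_aug P) -> _}) (res_aug P).
Proof. exact/ses_ker/res_epi. Qed.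

(** * Ext *)

Definition extends_along Z : linpred R := fun U V f =>
  forall h : {linear U -> Z}, exists g : {linear V -> Z}, forall u, g (f u) = h u.

Lemma extends_along_admissible Z : admissible (extends_along Z).
Proof.
split.
- by move=> U V f r rf h; exists (h \o r) => u /=; rewrite rf.
- move=> U V W f g h hgf hZ k; have [l lE] := hZ k.
  by exists (l \o g) => u /=; rewrite -hgf lE.
- move=> U V W f g h hgf fZ gZ k; have [l lE] := fZ k; have [m mE] := gZ l.
  by exists m => u; rewrite hgf mE lE.
- move=> E K K' P P' k p k' p' u u' kp kp' pk' p'k kZ uZ h.
  have [h1 h1E] := kZ h; have [g gE] := uZ (h1 \o k').
  pose d : {linear E -> Z} := h1 \- (g \o p).
  have dE x : d x = h1 x - g (p x) by [].
  have [_ ex' pe'] := kp'; have [|l lE] := @factor_epi _ _ _ _ p' d pe'.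
    by move=> x /ex'[y <-]; rewrite dE pk' gE subrr.
  exists l => x; rewrite -p'k lE dE h1E (ses_comp0 _ kp).
  by rewrite linear0 subr0.
Qed.

Definition ext_vanish Z := vanish (extends_along Z).

(** A projective resolution of a syzygy [K] of [A] splices into one of [A], and
    a projective resolution of [A] starts with a presentation: so each degree
    of Ext reduces to the previous one on a syzygy, and degree [1] to the
    extension of maps, a cocycle being a map on the first syzygy. *)
Lemma Ext_zero_vanish j A Z : Ext_zero j.+1 A Z <-> ext_vanish Z j A.
Proof.
split; elim: j A => [|j IHj] A.
- move=> AZ K P i p ip Pproj h.
  have [Q Qproj] := proj_resolution_exists K.
  have [|g gE] := AZ _ (res_cons_proj ip Pproj Qproj) (h \o res_aug Q).
    by move=> x /=; rewrite (res_exact0 Q _).2 ?linear0 //; exists x.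
  by exists g => k; have [x <-] := res_epi Q k; exact: (esym (gE x)).
- move=> AZ K P i p ip Pproj; apply: IHj => Q Qproj.
  exact: (AZ _ (res_cons_proj ip Pproj Qproj)).
- move=> AZ P Pproj f fd.
  have [|h hE] := factor_epi (h := f) (@res_tail_epi _ P).
    by move=> x /(res_exact0 (res_tail P))[y <-]; exact: fd.
  have [g gE] := AZ _ _ _ _ (ses_res_aug P) (Pproj 0) h.
  by exists g => x; rewrite -res_tail_augE gE hE.
- move=> AZ P Pproj.
  have := IHj _ (AZ _ _ _ _ (ses_res_aug P) (Pproj 0)) (res_tail P).
  by apply=> i; exact: Pproj.
Qed.

Lemma extends_along_iso Z Z' (U V : lmodType R) (f : {linear U -> V}) :
  lmod_iso Z Z' -> extends_along Z f -> extends_along Z' f.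
Proof.
move=> ZZ'; have [s [sm se]] := lmod_iso_sym ZZ'; move=> fZ h.
have [g gE] := fZ (s \o h).
have [|l lE] := @factor_mono _ _ _ _ s g sm; first by move=> v; exact: se.
by exists l => u; apply: sm; rewrite lE gE.
Qed.

Lemma ext_vanish_iso j A Z Z' :
  lmod_iso Z Z' -> ext_vanish Z j A -> ext_vanish Z' j A.
Proof.
move=> ZZ'; elim: j A => [|j IHj] A AZ K P i p ip Pproj.
  exact: (extends_along_iso ZZ' (AZ _ _ _ _ ip Pproj)).
exact/IHj/(AZ _ _ _ _ ip Pproj).
Qed.

(** The pullback of [C -> Z] along [f] is an extension of [L] by [K].  The
    identity of [K] extends to it, hence the extension splits. *)
Lemma ext_vanish0_lift (L K C Z : lmodType R) (k : {linear K -> C}) (c : {linear C -> Z})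
    (f : {linear L -> Z}) :
  short_exact k c -> ext_vanish K 0 L ->
  exists g : {linear L -> C}, forall x, c (g x) = f x.
Proof.
move=> kc LK; have [km ex ce] := kc.
have [E [a [b [ab mk inj]]]] := pullback c f.
have [i [ib ia]] := pullback_kernel kc ab mk inj; have [_ exb be] := ib.
have [r rE] := vanish0_ses (extends_along_admissible K) ib LK idfun.
have [|g gE] := @factor_epi _ _ _ _ b (a \- (k \o r)) be.
  by move=> _ /exb[x <-]; rewrite /= rE ia subrr.
exists g => x; have [e <-] := be x.
by rewrite gE linearB /= ab (ses_comp0 _ kc) subr0.
Qed.

(** The long exact sequence in the second variable, where syzygies of [A] leave
    only the lowest degree to treat. *)
Lemma ext_vanish_quotient j (A K C Z : lmodType R) (k : {linear K -> C}) (c : {linear C -> Z}) :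
  short_exact k c -> ext_vanish C j A -> ext_vanish K j.+1 A -> ext_vanish Z j A.
Proof.
move=> kc; elim: j A => [|j IHj] A AC AK L F l q lq Fproj.
  move=> f; have [g gE] := ext_vanish0_lift f kc (AK _ _ _ _ lq Fproj).
  have [h hE] := AC _ _ _ _ lq Fproj g.
  by exists (c \o h) => x; rewrite /= hE gE.
by apply: IHj; [exact: AC lq Fproj|exact: AK lq Fproj].
Qed.

Lemma ext_vanish_dsum (I : choiceType) j A Z :
  ext_vanish Z j A -> ext_vanish Z j (dsum I A).
Proof.
have Zadm := extends_along_admissible Z.
elim: j A => [|j IHj] A AZ;
  have [K [P [i [p [ip Pproj]]]]] := presentation A;
  have ips := dsum_ses I ip; have IPproj := dsum_projective (I := I) Pproj.
  apply: (vanish0_intro Zadm ips IPproj) => h.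
  have /choice[g gE] : forall m, exists g : {linear P -> Z},
      forall x, g (i x) = h (single m x).
    by move=> m; exact: (AZ _ _ _ _ ip Pproj (h \o mk_linear (single_linear m))).
  have [l lE] := dsum_lift g; exists l => x.
  rewrite -[LHS]/((l \o dsum_map i) x); apply: dsum_ext => m a /=.
  by rewrite dsum_map_single lE gE.
exact/(vanishS_intro Zadm ips IPproj)/IHj/(AZ _ _ _ _ ip Pproj).
Qed.

End Resolutions.
Arguments res_cons_proj {R K P A i p} ip {Q} _ _.

(** * Classes with a finite resolution *)

Section FiniteResolutions.
Variable R : pzRingType.
Implicit Types (C : modclass R) (A K U : lmodType R).

Definition iso_closed C := forall U V, lmod_iso U V -> C U -> C V.

(** The classes of modules with a finite (co)resolution, read one term at a
    time, which is the form that an induction on the length uses. *)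
Fixpoint resolved C m A : Prop :=
  C A \/
  if m is m'.+1 then exists (K U : lmodType R) (i : {linear K -> U})
    (p : {linear U -> A}), [/\ short_exact i p, C U & resolved C m' K]
  else False.

Fixpoint coresolved C m A : Prop :=
  C A \/
  if m is m'.+1 then exists (U K : lmodType R) (i : {linear A -> U})
    (p : {linear U -> K}), [/\ short_exact i p, C U & coresolved C m' K]
  else False.

Lemma resolved_base C m A : C A -> resolved C m A.
Proof. by case: m => [|m]; left. Qed.

Lemma coresolved_base C m A : C A -> coresolved C m A.
Proof. by case: m => [|m]; left. Qed.

Lemma wedge_resolved C m A : iso_closed C -> wedge C m A -> resolved C m A.
Proof.
move=> Ciso; elim: m A => [|m IHm] A [P [[|k] [km CP P0]]] //; last first.
  right; exists (ker (res_aug P)), (res_obj P 0), val, (res_aug P).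
  split; [exact: ses_res_aug|exact: CP|].
  apply: IHm; exists (res_tail P), k; split=> // i; first exact: (CP i.+1).
  exact: (P0 i.+1).
all: apply: resolved_base; apply: Ciso (CP 0 _) => //; exists (res_aug P).
all: split; last exact: res_epi.
all: apply: mono_ker0 => x /res_exact0[y <-]; by rewrite (P0 1 isT y) linear0.
Qed.

Definition point_obj A (i : nat) : lmodType R := if i is 0 then A else zero_mod R.

Definition point_res A : resolution A.
Proof.
apply: (@Resolution R A (point_obj A) (fun i => zero_map _ _) idfun).
- by move=> a; exists a.
- by move=> a; split=> [a0|[u <-]] //; exists 0; exact: esym a0.
- by move=> i x; split=> // _; exists 0; rewrite linear0 (zero_mod0 x).
Defined.

Lemma resolved_wedge C m A : resolved C m A -> wedge C m A.
Proof.
have base m' B : C B -> wedge C m' B.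
  move=> CB; exists (point_res B), 0; split=> // [[]//|[//|i _]].
  exact: zero_mod0.
elim: m A => [|m IHm] A [|]; [exact: base|by []|exact: base|].
move=> [K [U [i [p [ip CU /IHm[Q [k [km CQ Q0]]]]]]]].
exists (res_cons ip Q), k.+1; split=> // [[//|j]|[//|j]] /=.
  exact: CQ.
exact: Q0.
Qed.

Section CoTail.
Variables (A : lmodType R) (P : coresolution A).

Lemma cores_tail_aug_ex :
  exists a : {linear coker (cores_aug P) -> cores_obj P 1},
    (forall x, a (coker_proj (cores_aug P) x) = cores_dif P 0 x) /\ mono a.
Proof.
have [|a aE] := @factor_epi _ _ _ _ (coker_proj (cores_aug P)) (cores_dif P 0)
  (@coker_proj_epi _ _ _ _).
  by move=> x /coker_proj_eq0 h; apply/cores_exact0.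
exists a; split=> //; apply: mono_ker0 => c.
have [x <-] := coker_proj_epi c; rewrite aE => /cores_exact0 h.
exact/coker_proj_eq0.
Qed.

Definition cores_tail_aug := projT1 (cid cores_tail_aug_ex).
Fact cores_tail_augE x :
  cores_tail_aug (coker_proj (cores_aug P) x) = cores_dif P 0 x.
Proof. by have [] := projT2 (cid cores_tail_aug_ex). Qed.
Fact cores_tail_mono : mono cores_tail_aug.
Proof. by have [] := projT2 (cid cores_tail_aug_ex). Qed.

Fact cores_tail_exact0 : exact_at cores_tail_aug (cores_dif P 1).
Proof.
move=> x; rewrite (cores_exact P 0); split=> [[y <-]|[c <-]].
  by exists (coker_proj (cores_aug P) y); rewrite cores_tail_augE.
by have [y <-] := coker_proj_epi c; exists y; rewrite cores_tail_augE.
Qed.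

Definition cores_tail : coresolution (coker (cores_aug P)) :=
  @Coresolution R _ (fun j => cores_obj P j.+1) (fun j => cores_dif P j.+1)
    cores_tail_aug cores_tail_mono cores_tail_exact0 (fun j => cores_exact P j.+1).

End CoTail.

Section CoCons.
Variables (A U K : lmodType R) (i : {linear A -> U}) (p : {linear U -> K}).
Hypothesis ip : short_exact i p.
Variable Q : coresolution K.

Definition cores_cons_obj (j : nat) : lmodType R :=
  if j is j'.+1 then cores_obj Q j' else U.

Definition cores_cons_dif (j : nat) :
    {linear cores_cons_obj j -> cores_cons_obj j.+1} :=
  match j with
  | 0 => cores_aug Q \o p
  | j'.+1 => cores_dif Q j'
  end.

Fact cores_cons_exact0 : exact_at i (cores_cons_dif 0).
Proof.
have [_ ex _] := ip; move=> x /=; rewrite -ex.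
by split=> [/(mono_eq0 (@cores_mono _ _ Q))|->] //; rewrite linear0.
Qed.

Fact cores_cons_exact j : exact_at (cores_cons_dif j) (cores_cons_dif j.+1).
Proof.
case: j => [|j] /=; last exact: cores_exact.
have [_ _ pe] := ip; move=> x /=; rewrite (cores_exact0 Q x).
split=> [[k <-]|[u <-]]; last by exists (p u).
by have [u <-] := pe k; exists u.
Qed.

Definition cores_cons : coresolution A :=
  @Coresolution R A cores_cons_obj cores_cons_dif i
    (let: And3 im _ _ := ip in im) cores_cons_exact0 cores_cons_exact.

End CoCons.

Definition point_cores A : coresolution A.
Proof.
apply: (@Coresolution R A (point_obj A) (fun i => zero_map _ _) idfun).
- by [].
- by move=> a; split=> // _; exists a.
- by move=> i x; split=> [_|[u <-]] //; exists 0; rewrite linear0 (zero_mod0 x).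
Defined.

Lemma vee_coresolved C m A : iso_closed C -> vee C m A -> coresolved C m A.
Proof.
move=> Ciso; elim: m A => [|m IHm] A [P [[|k] [km CP P0]]] //; last first.
  right; exists (cores_obj P 0), (coker (cores_aug P)), (cores_aug P),
    (coker_proj (cores_aug P)).
  split; [exact/ses_coker/cores_mono|exact: CP|].
  apply: IHm; exists (cores_tail P), k; split=> // i; first exact: (CP i.+1).
  exact: (P0 i.+1).
all: apply: coresolved_base; apply: Ciso (CP 0 _) => //.
all: apply: lmod_iso_sym; exists (cores_aug P); split; first exact: cores_mono.
all: by move=> x; apply/cores_exact0; exact: (P0 1).
Qed.

Lemma coresolved_vee C m A : coresolved C m A -> vee C m A.
Proof.
have base m' B : C B -> vee C m' B.
  move=> CB; exists (point_cores B), 0; split=> // [[]//|[//|i _]].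
  exact: zero_mod0.
elim: m A => [|m IHm] A [|]; [exact: base|by []|exact: base|].
move=> [U [K [i [p [ip CU /IHm[Q [k [km CQ Q0]]]]]]]].
exists (cores_cons ip Q), k.+1; split=> // [[//|j]|[//|j]] /=.
  exact: CQ.
exact: Q0.
Qed.

End FiniteResolutions.

(** * Tensor products and Tor *)

Section TensorTools.
Variables (R S : pzRingType) (M : bimodType R S).
Implicit Types (X : lmodType R) (Y K P A : lmodType S).

Lemma ractr0 (m : M) : ract m (0 : S) = 0.
Proof. by apply: (addrI (ract m 0)); rewrite -ractDr !addr0. Qed.

Lemma pure0l Y (y : Y) : pure (0 : M) y = 0.
Proof. by apply: (addrI (pure 0 y)); rewrite -pureDl !addr0. Qed.

Lemma pure0r Y (m : M) : pure m (0 : Y) = 0.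
Proof. by apply: (addrI (pure m 0)); rewrite -pureDr !addr0. Qed.

Lemma tensor_ext X Y (f g : {linear tensor M Y -> X}) :
  (forall m y, f (pure m y) = g (pure m y)) -> f =1 g.
Proof.
move=> fg u; rewrite -[u]tensor_reprK tensor_classE !linear_sum.
by apply: eq_bigr => p _.
Qed.

Lemma tensor_lift X Y (a : {linear Y -> hom_mod M X}) :
  exists f : {linear tensor M Y -> X}, forall m y, f (pure m y) = hom_fun (a y) m.
Proof.
pose ev (p : M * Y) : X := hom_fun (a p.2) p.1.
pose sumev s := \sum_(p <- s) ev p.
have evl y : linear (hom_fun (a y)) by move=> r m m'; rewrite /hom_fun linearP.
have wd s t : tensor_eq s t -> sumev s = sumev t.
  rewrite /sumev; elim=> {s t} //=.
  - by move=> s t u _ -> _ ->.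
  - by move=> s s' t t' _ ss' _ tt'; rewrite !big_cat /= ss' tt'.
  - by move=> s t; rewrite !big_cat /= addrC.
  - by move=> y; rewrite big_seq1 big_nil /ev /= -(mk_linearE (evl y)) linear0.
  - move=> m m' y; rewrite big_seq1 !big_cons big_nil addr0 /ev /=.
    by rewrite -!(mk_linearE (evl y)) linearD.
  - move=> m y y'; rewrite big_seq1 !big_cons big_nil addr0 /ev /=.
    by rewrite linearD.
  - by move=> m s y; rewrite !big_seq1 /ev /= linearZ.
have fE s : sumev (tensor_repr (tensor_class s)) = sumev s.
  exact/wd/tensor_repr_eq.
have fl : linear (fun u : tensor M Y => sumev (tensor_repr u)).
  move=> r u v; rewrite -[u]tensor_reprK -[v]tensor_reprK.
  rewrite -[r *: _]tensor_class_scale -[X in tensor_repr X]tensor_class_cat !fE.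
  rewrite /sumev big_cat /= scaler_sumr big_map; congr (_ + _).
  by apply: eq_bigr => p _; rewrite /ev /= -!(mk_linearE (evl p.2)) linearZ.
exists (mk_linear fl) => m y.
by rewrite mk_linearE [LHS](fE [:: (m, y)]) /sumev big_seq1.
Qed.

Definition lift_map X Y (a : {linear Y -> hom_mod M X}) : {linear tensor M Y -> X} :=
  projT1 (cid (tensor_lift a)).

Lemma lift_mapE X Y (a : {linear Y -> hom_mod M X}) m y :
  lift_map a (pure m y) = hom_fun (a y) m.
Proof. exact: projT2 (cid (tensor_lift a)) m y. Qed.

Lemma tensor_map_comp Y K P (f : {linear Y -> K}) (g : {linear K -> P})
    (h : {linear Y -> P}) (u : tensor M Y) :
  (forall y, h y = g (f y)) -> tensor_map h u = tensor_map g (tensor_map f u).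
Proof.
move=> hE; rewrite -[RHS]/((tensor_map g \o tensor_map f) u).
by apply: tensor_ext => m y; rewrite /= !tensor_map_pure hE.
Qed.

Lemma tensor_map_id Y (f : {linear Y -> Y}) (u : tensor M Y) :
  (forall y, f y = y) -> tensor_map f u = u.
Proof.
move=> fE; rewrite -[RHS]/(idfun u).
by apply: tensor_ext => m y; rewrite /= tensor_map_pure fE.
Qed.

Lemma tensor_map0 Y K (f : {linear Y -> K}) (u : tensor M Y) :
  (forall y, f y = 0) -> tensor_map f u = 0.
Proof.
move=> fE; rewrite -[RHS]/(zero_map (tensor M Y) (tensor M K) u).
by apply: tensor_ext => m y; rewrite /= tensor_map_pure fE pure0r.
Qed.

Lemma tensor_zero_mod Y : is_zero Y -> is_zero (tensor M Y).
Proof.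
move=> Y0 u; rewrite -(tensor_map_id u (f := idfun)) //.
by apply: tensor_map0 => y; rewrite (Y0 y).
Qed.

(** The cokernel [C] of [M (x) K -> M (x) P] receives a map from [M (x) A], the
    transpose of the map [A -> Hom (M, C)] induced by [P -> Hom (M, C)]. *)
Lemma tensor_right_exact K P A (i : {linear K -> P}) (p : {linear P -> A}) :
  short_exact i p ->
  exact_at (tensor_map i : tensor M K -> _) (tensor_map p) /\
  epi (tensor_map p : tensor M P -> _).
Proof.
move=> ip; have [_ ex pe] := ip; split; last first.
  move=> u; rewrite -[u]tensor_reprK tensor_classE.
  elim: (tensor_repr u) => [|[m a] s [v vE]].
    by exists 0; rewrite linear0 big_nil.
  have [x <-] := pe a; exists (pure m x + v).
  by rewrite linearD big_cons /= tensor_map_pure vE.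
move=> u; split=> [pu|[v <-]]; last first.
  rewrite -(tensor_map_comp (h := p \o i)) //; apply: tensor_map0 => y /=.
  exact: ses_comp0 ip.
pose c : {linear tensor M P -> coker (tensor_map i : {linear tensor M K -> _})} :=
  coker_proj (tensor_map i).
have [|b bE] := @factor_epi _ _ _ _ p (adjoint c) pe.
  move=> x /ex[k <-]; apply: hom_eq => m; rewrite /hom_fun /= /adjoint_fun.
  by apply/coker_proj_eq0; exists (pure m k); exact: tensor_map_pure.
have [t tE] := tensor_lift b.
have tc v : t (tensor_map p v) = c v.
  rewrite -[LHS]/((t \o tensor_map p) v); apply: tensor_ext => m x /=.
  by rewrite tensor_map_pure tE bE.
by apply/coker_proj_eq0; rewrite -[LHS]tc pu linear0.
Qed.

Definition stays_mono : linpred S := fun U V f =>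
  mono (tensor_map f : tensor M U -> tensor M V).

Lemma stays_mono_admissible : admissible stays_mono.
Proof.
split.
- move=> U V f r rf u v fuv.
  rewrite -(tensor_map_id u (f := r \o f)) // -(tensor_map_id v (f := r \o f)) //.
  by rewrite !(tensor_map_comp (f := f) (g := r)) // fuv.
- by move=> U V W f g h hgf hm u v fuv; apply: hm; rewrite !(tensor_map_comp _ hgf) fuv.
- by move=> U V W f g h hgf fm gm u v; rewrite !(tensor_map_comp _ hgf) => /gm/fm.
- move=> E K K' P P' k p k' p' u u' kp kp' pk' p'k km um.
  apply: mono_ker0 => x /=; have [ex' _] := tensor_right_exact kp'.
  rewrite (tensor_map_comp (f := k) (g := p')) // => /ex'[w wE].
  have w0 : w = 0.
    apply: (mono_eq0 um); rewrite /= (tensor_map_comp (f := k') (g := p)) // wE.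
    rewrite -(tensor_map_comp (h := p \o k)) //; apply: tensor_map0 => y /=.
    exact: ses_comp0 kp.
  by apply: (mono_eq0 km); rewrite /= -wE w0 linear0.
Qed.

Definition tor_vanish := vanish stays_mono.

Lemma Tor_zero_vanish j A : Tor_zero j.+1 M A -> tor_vanish j A.
Proof.
elim: j A => [|j IHj] A AM K P i p ip Pproj.
  have [Q Qproj] := proj_resolution_exists K.
  apply: mono_ker0 => u /= iu.
  have Qs := ses_res_aug Q; have [ex ae] := tensor_right_exact Qs.
  have [w wu] := ae u.
  have [|v vE] := AM _ (res_cons_proj ip Pproj Qproj) w.
    by rewrite (tensor_map_comp (f := res_aug Q) (g := i)) // wu.
  rewrite -wu -[w]vE -(tensor_map_comp (h := res_aug Q \o res_dif Q 0)) //.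
  by apply: tensor_map0 => x; apply/(res_exact0 Q); exists x.
by apply: IHj => Q Qproj; exact: (AM _ (res_cons_proj ip Pproj Qproj)).
Qed.

End TensorTools.
Arguments tor_vanish {R S} M j A.
Arguments stays_mono {R S} M [U V] f.
Arguments stays_mono_admissible {R S} M.

(** * Modules over the triangular ring as triples *)

Section Corner.
Variables (R0 L : pzRingType).

(** The image of the unit is only an idempotent [e], as for the inclusion of a
    diagonal entry in a matrix ring; a module [V] over the large ring then
    restricts to the summand [e V]. *)
Record corner_map : Type := CornerMap {
  cm_fun :> R0 -> L;
  cmD : {morph cm_fun : a b / a + b};
  cmM : {morph cm_fun : a b / a * b}
}.

Variables (c : corner_map) (V : lmodType L).

Definition in_corner : {pred V} := fun v => c 1 *: v == v.

Fact in_corner_zmod : zmod_closed in_corner.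
Proof.
split=> [|u v]; first by rewrite unfold_in /in_corner scaler0.
by rewrite !unfold_in /in_corner scalerBr => /eqP-> /eqP->.
Qed.
HB.instance Definition _ := GRing.isZmodClosed.Build V in_corner in_corner_zmod.

Definition corner : Type := {v : V | in_corner v}.
HB.instance Definition _ := Choice.on corner.
HB.instance Definition _ := SubType.on corner.
HB.instance Definition _ := [SubChoice_isSubZmodule of corner by <:].

Lemma cm_scale_corner a v : in_corner (c a *: v).
Proof. by rewrite /in_corner scalerA -cmM mul1r. Qed.

Lemma corner_id (v : corner) : c 1 *: val v = val v.
Proof. exact/eqP/(valP v). Qed.

Definition corner_scale (a : R0) (v : corner) : corner :=
  exist _ (c a *: val v) (cm_scale_corner a (val v)).

Fact corner_scalerA a b v : corner_scale a (corner_scale b v) = corner_scale (a * b) v.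
Proof. by apply: val_inj; rewrite /= scalerA cmM. Qed.
Fact corner_scale1r : left_id 1 corner_scale.
Proof. by move=> v; apply: val_inj; rewrite /= corner_id. Qed.
Fact corner_scalerDr : right_distributive corner_scale +%R.
Proof. by move=> a v w; apply: val_inj; rewrite /= scalerDr. Qed.
Fact corner_scalerDl v : {morph corner_scale^~ v : a b / a + b}.
Proof. by move=> a b; apply: val_inj; rewrite /= cmD scalerDl. Qed.
HB.instance Definition _ := GRing.Zmodule_isLmodule.Build R0 corner
  corner_scalerA corner_scale1r corner_scalerDr corner_scalerDl.

End Corner.

Section Triples.
Variables (R S : pzRingType) (M : bimodType R S).
Implicit Types T : triple M.

Notation L := (tri_ring M).

Lemma tri_scaleE T (r : R) (m : M) (s : S) (x : fstc T) (y : sndc T) :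
  ((r, m, s) : L) *: ((x, y) : tri_mod T) =
    (r *: x + structmap T (pure m y), s *: y) :> tri_mod T.
Proof. by []. Qed.

Section TripleMaps.
Variables (T T' : triple M).

Definition tri_compat (f1 : {linear fstc T -> fstc T'})
    (f2 : {linear sndc T -> sndc T'}) : Prop :=
  forall m y, f1 (structmap T (pure m y)) = structmap T' (pure m (f2 y)).

Definition tri_comps (f : {linear tri_mod T -> tri_mod T'})
    (f1 : {linear fstc T -> fstc T'}) (f2 : {linear sndc T -> sndc T'}) : Prop :=
  forall x y, f (x, y) = (f1 x, f2 y).

Lemma tri_map_intro f1 f2 : tri_compat f1 f2 ->
  exists f : {linear tri_mod T -> tri_mod T'}, tri_comps f f1 f2.
Proof.
move=> cf.
have fl : linear (fun v : tri_mod T => (f1 v.1, f2 v.2) : tri_mod T').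
  move=> [[r m] s] [x y] [x' y']; rewrite tri_scaleE.
  by congr (_, _); rewrite /= !linearD !linearZ //= cf.
by exists (mk_linear fl).
Qed.

(** A linear map commutes with the two diagonal idempotents, hence preserves
    the two components; the compatibility with the structure maps is the
    linearity for the off-diagonal entries. *)
Lemma tri_map_elim (f : {linear tri_mod T -> tri_mod T'}) :
  exists f1 f2, tri_comps f f1 f2 /\ tri_compat f1 f2.
Proof.
have f1E x : f (x, 0) = ((f (x, 0)).1, 0).
  have e : (x, 0) = ((1, 0, 0) : L) *: ((x, 0) : tri_mod T) :> tri_mod T.
    by rewrite tri_scaleE scale1r pure0l linear0 addr0 scaler0.
  rewrite {1}e linearZ /=; case: (f (x, 0)) => x' y'.
  by rewrite tri_scaleE scale1r pure0l linear0 addr0 scale0r.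
have f2E y : f (0, y) = (0, (f (0, y)).2).
  have e : (0, y) = ((0, 0, 1) : L) *: ((0, y) : tri_mod T) :> tri_mod T.
    by rewrite tri_scaleE scale1r pure0l linear0 addr0 scaler0.
  rewrite {1}e linearZ /=; case: (f (0, y)) => x' y'.
  by rewrite tri_scaleE scale1r pure0l linear0 addr0 scale0r.
have l1 : linear (fun x => (f (x, 0)).1).
  move=> r x x'.
  have -> : (r *: x + x', 0) = ((r, 0, 0) : L) *: ((x, 0) : tri_mod T) + (x', 0) :> tri_mod T.
    by rewrite tri_scaleE pure0l linear0 addr0 scaler0; congr (_, _); rewrite /= addr0.
  rewrite linearP /= [f (x, 0)]f1E tri_scaleE pure0l linear0 addr0 /=.
  by case: (f (x', 0)).
have l2 : linear (fun y => (f (0, y)).2).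
  move=> s y y'.
  have -> : (0, s *: y + y') = ((0, 0, s) : L) *: ((0, y) : tri_mod T) + (0, y') :> tri_mod T.
    by rewrite tri_scaleE pure0l linear0 scaler0; congr (_, _); rewrite /= !addr0.
  rewrite linearP /= [f (0, y)]f2E tri_scaleE /=.
  by case: (f (0, y')).
exists (mk_linear l1), (mk_linear l2); split=> [x y|m y]; rewrite !mk_linearE.
  have -> : (x, y) = ((x, 0) : tri_mod T) + (0, y) :> tri_mod T.
    by congr (_, _); rewrite /= ?addr0 ?add0r.
  rewrite linearD /= f1E f2E; congr (_, _); by rewrite /= ?addr0 ?add0r.
have -> : (structmap T (pure m y), 0) = ((0, m, 0) : L) *: ((0, y) : tri_mod T) :> tri_mod T.
  by rewrite tri_scaleE scaler0 add0r scale0r.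
by rewrite linearZ /= [f (0, y)]f2E tri_scaleE scaler0 add0r.
Qed.

End TripleMaps.

Lemma tri_mono T T' (f : {linear tri_mod T -> tri_mod T'}) f1 f2 :
  tri_comps f f1 f2 -> mono f <-> mono f1 /\ mono f2.
Proof.
move=> fE; split=> [fm|[m1 m2] [x y] [x' y']].
  split=> x y xy.
    have : f (x, 0) = f (y, 0) by rewrite !fE xy.
    by move=> /fm[].
  have : f (0, x) = f (0, y) by rewrite !fE xy.
  by move=> /fm[].
by rewrite !fE => -[/m1-> /m2->].
Qed.

Lemma tri_epi T T' (f : {linear tri_mod T -> tri_mod T'}) f1 f2 :
  tri_comps f f1 f2 -> epi f <-> epi f1 /\ epi f2.
Proof.
move=> fE; split=> [fe|[e1 e2] [x y]].
  split=> x.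
    by have [[a b]] := fe (x, 0); rewrite fE => -[<- _]; exists a.
  by have [[a b]] := fe (0, x); rewrite fE => -[_ <-]; exists b.
by have [a <-] := e1 x; have [b <-] := e2 y; exists (a, b); rewrite fE.
Qed.

Lemma tri_ses T1 T2 T3 (f : {linear tri_mod T1 -> tri_mod T2})
    (g : {linear tri_mod T2 -> tri_mod T3}) f1 f2 g1 g2 :
  tri_comps f f1 f2 -> tri_comps g g1 g2 ->
  short_exact f g <-> short_exact f1 g1 /\ short_exact f2 g2.
Proof.
move=> fE gE; split=> [[fm ex ge]|[[m1 x1 e1] [m2 x2 e2]]].
  have [m1 m2] := (tri_mono fE).1 fm; have [e1 e2] := (tri_epi gE).1 ge.
  split; split=> // v.
    have [h1 h2] := ex (v, 0); split=> [gv|[u uv]].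
      have [|[a b]] := h1; first by rewrite gE gv linear0.
      by rewrite fE => -[<- _]; exists a.
    have := h2 (ex_intro _ (u, 0) _); rewrite gE => h; apply: (congr1 fst (h _)).
    by rewrite fE uv linear0.
  have [h1 h2] := ex (0, v); split=> [gv|[u uv]].
    have [|[a b]] := h1; first by rewrite gE gv linear0.
    by rewrite fE => -[_ <-]; exists b.
  have := h2 (ex_intro _ (0, u) _); rewrite gE => h; apply: (congr1 snd (h _)).
  by rewrite fE uv linear0.
split; [exact/(tri_mono fE)| |exact/(tri_epi gE)].
move=> [x y]; rewrite gE; split=> [[/x1[a <-] /x2[b <-]]|[[a b]]].
  by exists (a, b).
rewrite fE => -[<- <-]; congr (_, _); [apply/x1|apply/x2].
  by exists a.
by exists b.
Qed.

Section ModuleTriple.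

Fact fst_cornerD : {morph (fun r : R => (r, 0, 0) : L) : a b / a + b}.
Proof. by move=> a b; congr (_, _, _); rewrite /= addr0. Qed.
Fact fst_cornerM : {morph (fun r : R => (r, 0, 0) : L) : a b / a * b}.
Proof. by move=> a b; congr (_, _, _); rewrite /= ?scaler0 ?ract0 ?addr0 ?mulr0. Qed.
Definition fst_corner := CornerMap fst_cornerD fst_cornerM.

Fact snd_cornerD : {morph (fun s : S => (0, 0, s) : L) : a b / a + b}.
Proof. by move=> a b; congr (_, _, _); rewrite /= addr0. Qed.
Fact snd_cornerM : {morph (fun s : S => (0, 0, s) : L) : a b / a * b}.
Proof. by move=> a b; congr (_, _, _); rewrite /= ?scaler0 ?ract0 ?addr0 ?mulr0. Qed.
Definition snd_corner := CornerMap snd_cornerD snd_cornerM.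

Lemma tri_mulE (r r' : R) (m m' : M) (s s' : S) :
  ((r, m, s) : L) * (r', m', s') = (r * r', r *: m' + ract m s', s * s').
Proof. by []. Qed.

Variable V : lmodType L.

Let off (m : M) : L := (0, m, 0).

Fact off_corner m (y : corner snd_corner V) : in_corner fst_corner (off m *: val y).
Proof.
by rewrite /in_corner scalerA /off /= tri_mulE mul1r scale1r ract0 addr0 mulr0.
Qed.

Let act m (y : corner snd_corner V) : corner fst_corner V :=
  exist (fun v => in_corner fst_corner v) _ (off_corner m y).

Fact act_linear y : linear (act^~ y).
Proof.
move=> r m m'; apply: val_inj; rewrite /= !scalerA -scalerDl; congr (_ *: _).
rewrite /= tri_mulE mulr0 ract0 addr0 mulr0.
by congr (_, _, _); rewrite /= addr0.
Qed.

Fact act_linear2 : linear (fun y => mk_linear (act_linear y) : hom_mod M _).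
Proof.
move=> s y y'; apply: hom_eq => m; apply: val_inj.
rewrite /= scalerDr !scalerA; congr (_ *: _ + _); rewrite tri_mulE.
by rewrite !mulr0 mul0r scale0r add0r.
Qed.

Definition module_triple : triple M :=
  Triple (lift_map (mk_linear act_linear2)).

Lemma module_triple_iso : lmod_iso (tri_mod module_triple) V.
Proof.
have sE m y : structmap module_triple (pure m y) = act m y.
  exact: lift_mapE.
have xE (a : L) (x : corner fst_corner V) : a *: val x = fst_corner a.1.1 *: val x.
  case: a => [[r m] s]; rewrite -{1}[val x]corner_id scalerA /= tri_mulE.
  by rewrite mulr1 mulr0 ractr0 addr0 scaler0.
have yE (a : L) (y : corner snd_corner V) :
    a *: val y = off a.1.2 *: val y + snd_corner a.2 *: val y.
  case: a => [[r m] s]; rewrite -{1}[val y]corner_id scalerA -scalerDl /= tri_mulE.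
  congr (_ *: _); rewrite mulr0 mulr1 ract1 scaler0 /off.
  by congr (_, _, _); rewrite /= ?addr0 ?add0r.
have gl : linear (fun v : tri_mod module_triple => val v.1 + val v.2 : V).
  move=> a [x y] [x' y']; rewrite scalerDr xE yE.
  case: a => [[r m] s]; rewrite tri_scaleE /= sE.
  by rewrite -!addrA; congr (_ + _); congr (_ + _); rewrite addrCA.
exists (mk_linear gl); split.
  apply: mono_ker0 => [[x y]]; rewrite mk_linearE /= => xy0.
  have x0 : val x = 0.
    have := congr1 ( *:%R (fst_corner 1)) xy0.
    rewrite scalerDr scaler0 corner_id yE /= /off -scalerDl.
    have -> : ((0, 0, 0) : L) + (0, 0, 0) = 0 by rewrite addr0.
    by rewrite scale0r addr0.
  move: xy0; rewrite x0 add0r => y0.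
  by congr (_, _); apply: val_inj.
move=> v; pose x := fst_corner 1 *: v; pose y := snd_corner 1 *: v.
exists (exist (fun v => in_corner fst_corner v) x (cm_scale_corner fst_corner 1 v),
  exist (fun v => in_corner snd_corner v) y (cm_scale_corner snd_corner 1 v)).
rewrite mk_linearE /= /x /y -scalerDl -[RHS]scale1r; congr (_ *: _).
by congr (_, _, _); rewrite /= ?addr0 ?add0r.
Qed.

End ModuleTriple.

Lemma tri_mod_exists (V : lmodType L) : exists T, lmod_iso (tri_mod T) V.
Proof. by exists (module_triple V); exact: module_triple_iso. Qed.

(** The first corner of the ring is [R + M] as a left [R]-module. *)
Lemma fst_corner_free (I : choiceType) :
  lmod_iso (fstc (module_triple (dsum I L^o))) (dsum I (R^o * M)%type).
Proof.
have fin (v : corner fst_corner (dsum I L^o)) : exists s : seq I, forall i,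
    i \notin s -> ((val v i : L).1.1 : R^o, (val v i : L).1.2 : M) = 0.
  by have [s vs] := dsum_fin (val v); exists s => i /vs ->.
pose g v : dsum I (R^o * M)%type := Dsum (fin v).
have gl : linear g.
  move=> r v w; apply: dsum_eq => i.
  rewrite -[RHS]/(r *: g v i + g w i) /=.
  have -> : ((r, 0, 0) : L) *: val v i = ((r, 0, 0) : L) * (val v i : L) by [].
  by case: (val v i : L) => [[a m] s]; rewrite tri_mulE ract0 addr0.
have c0 (v : corner fst_corner (dsum I L^o)) i : (val v i : L).2 = 0.
  have := congr1 (dsum_coord i) (corner_id v); rewrite /dsum_coord /=.
  have -> : ((1, 0, 0) : L) *: val v i = ((1, 0, 0) : L) * (val v i : L) by [].
  by case: (val v i : L) => [[a m] s]; rewrite tri_mulE mul0r => -[].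
exists (mk_linear gl); split=> [v w|x].
  rewrite !mk_linearE => vw; apply: val_inj; apply: dsum_eq => i.
  have := congr1 (dsum_coord i) vw; rewrite /dsum_coord /=.
  have := c0 v i; have := c0 w i.
  by case: (val v i : L) => [[a m] s]; case: (val w i : L) => [[a' m'] s'] /= -> -> [-> ->].
have fin' : exists s : seq I, forall i, i \notin s -> (((x i).1, (x i).2, 0) : L^o) = 0.
  by have [s xs] := dsum_fin x; exists s => i /xs ->.
have vc : in_corner fst_corner (Dsum fin' : dsum I L^o).
  apply/eqP/dsum_eq => i /=.
  have -> : forall a : L^o, ((1, 0, 0) : L) *: a = ((1, 0, 0) : L) * (a : L) by [].
  by rewrite tri_mulE mul1r scale1r mulr0 ract0 addr0.
exists (exist (fun v => in_corner fst_corner v) _ vc).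
by rewrite mk_linearE; apply: dsum_eq => i /=; case: (x i).
Qed.

End Triples.

(** * Ext over the triangular ring *)

Section TriangularExt.
Variables (R S : pzRingType) (M : bimodType R S).
Implicit Types (T D : triple M) (X Z : lmodType R) (Y W : lmodType S).

Notation L := (tri_ring M).

Definition fst_triple X : triple M :=
  @Triple _ _ _ X (zero_mod S) (zero_map (tensor M (zero_mod S)) X).
Definition snd_triple Y : triple M :=
  @Triple _ _ _ (zero_mod R) Y (zero_map (tensor M Y) (zero_mod R)).
Definition tensor_triple Y : triple M :=
  @Triple _ _ _ (tensor M Y) Y idfun.
Definition hom_triple Z : triple M :=
  @Triple _ _ _ Z (hom_mod M Z) (lift_map (idfun : {linear hom_mod M Z -> _})).

Lemma ses_id_zero (Q : pzRingType) (U : lmodType Q) : is_zero U ->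
  short_exact (idfun : {linear U -> U}) (idfun : {linear U -> U}).
Proof.
move=> U0; split=> // v; last by exists v.
by split=> _; [exists v|exact: U0].
Qed.

Lemma ses_zero_id (Q : pzRingType) (U Z0 : lmodType Q) : is_zero Z0 ->
  short_exact (zero_map Z0 U) (idfun : {linear U -> U}).
Proof.
move=> Z00; split=> [x y _|v|v]; first by rewrite (Z00 x) (Z00 y).
  by split=> [/esym|[u <-]] // v0; exists 0.
by exists v.
Qed.

Lemma ses_id_to_zero (Q : pzRingType) (U Z0 : lmodType Q) : is_zero Z0 ->
  short_exact (idfun : {linear U -> U}) (zero_map U Z0).
Proof.
move=> Z00; split=> // v; last by exists 0; rewrite linear0 (Z00 v).
by split=> // _; exists v.
Qed.

Lemma ses_prod (Q : pzRingType) (U V : lmodType Q) :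
  exists i : {linear U -> (U * V)%type},
    short_exact i (snd : {linear (U * V)%type -> V}).
Proof.
have il : linear (fun u : U => (u, 0 : V)).
  by move=> a u v; congr (_, _); rewrite /= scaler0 addr0.
exists (mk_linear il); split=> [u v []|[u v]|v] //; last by exists (0, v).
by split=> [/= ->|[x [_ <-]]] //; exists u.
Qed.

(** Every module being isomorphic to one given by a triple, it is enough to
    lift along epimorphisms between the latter. *)
Lemma tri_projective T :
  (forall (U V : triple M) (g : {linear tri_mod U -> tri_mod V})
     (f : {linear tri_mod T -> tri_mod V}), epi g ->
     exists h : {linear tri_mod T -> tri_mod U}, forall x, g (h x) = f x) ->
  projective (tri_mod T).
Proof.
move=> lift U V g f ge.
have [TU [u [_ ue]]] := tri_mod_exists U.
have [TV /lmod_iso_sym[v [vm ve]]] := tri_mod_exists V.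
have [|h hE] := lift TU TV (v \o g \o u) (v \o f).
  by move=> x; have [y <-] := ve x; have [z <-] := ge y; have [w <-] := ue z; exists w.
by exists (u \o h) => x; apply: vm; exact: hE.
Qed.

(** The second component has the exact right adjoint [Y |-> (0, Y)]. *)
Lemma snd_projective T : projective (tri_mod T) -> projective (sndc T).
Proof.
move=> Tproj U V g f ge.
have [|G GE] := @tri_map_intro _ _ _ (snd_triple U) (snd_triple V) idfun g.
  by move=> m y.
have [|F FE] := @tri_map_intro _ _ _ T (snd_triple V) (zero_map _ _) f.
  by move=> m y.
have [|h hE] := Tproj _ _ G F.
  by apply/(tri_epi GE); split=> // x; exists x.
have [h1 [h2 [hc _]]] := tri_map_elim h.
by exists h2 => y; have := hE (0, y); rewrite hc GE FE => -[].
Qed.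

(** The middle term is a free module, whose first component is known: this
    is what the vanishing of Ext on first components depends on. *)
Lemma tri_presentation T : exists (TL TF : triple M)
    (f : {linear tri_mod TL -> tri_mod TF}) (g : {linear tri_mod TF -> tri_mod T}),
  [/\ short_exact f g, projective (tri_mod TF) &
      exists I : choiceType, lmod_iso (dsum I (R^o * M)%type) (fstc TF)].
Proof.
have [p pe] := free_cover (tri_mod T).
have isoF := module_triple_iso (dsum (tri_mod T) L^o).
have [s [_ se]] := isoF.
have ge : epi (p \o s).
  by move=> x; have [y <-] := pe x; have [z <-] := se y; exists z.
have [TL [t [tm te]]] := tri_mod_exists (ker (p \o s)).
exists TL, (module_triple (dsum (tri_mod T) L^o)), (val \o t), (p \o s); split.
- have [vm ex _] := ses_ker ge; split=> // [x y /vm/tm //|v].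
  rewrite ex; split=> [[k <-]|[x <-]]; last by exists (t x).
  by have [x <-] := te k; exists x.
- exact/(projective_iso (lmod_iso_sym isoF))/free_projective.
- by exists (tri_mod T); apply: lmod_iso_sym; exact: fst_corner_free.
Qed.

Lemma ext_vanish_fst_free Z j (I : choiceType) :
  ext_vanish Z j (M : lmodType R) -> ext_vanish Z j (dsum I (R^o * M)%type).
Proof.
move=> MZ; apply: ext_vanish_dsum.
have [i ip] := ses_prod (R^o : lmodType R) (M : lmodType R).
apply: (vanish_ext (extends_along_admissible Z) ip) MZ.
exact/(vanish_projective (extends_along_admissible Z))/regular_projective.
Qed.

(** When [N -> Hom (M, Z)] is onto, [D = (Z, N)] is an extension of
    [(Z, Hom (M, Z))] by [(0, K)], where [K] is the kernel.  A map into [D] from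
    a syzygy is extended in two steps: its first component extends by the
    vanishing of Ext into [Z], and projectivity lifts the result to [D]; the
    error is a map to [K], which extends by the vanishing of Ext into [K].
    The first components of projective modules are not projective, but sums of
    copies of [R] and [M], whence the condition on [M]. *)
Lemma ext_vanish_epi_adjoint j T D :
    epi (adjoint (structmap D)) ->
    ext_vanish (fstc D) j (fstc T) ->
    ext_vanish (ker (adjoint (structmap D))) j (sndc T) ->
    (forall i, (i < j)%N -> ext_vanish (fstc D) i (M : lmodType R)) ->
  ext_vanish (tri_mod D) j (tri_mod T).
Proof.
move=> De; have Dadm := extends_along_admissible (tri_mod D).
have Zadm := extends_along_admissible (fstc D).
have Kadm := extends_along_admissible (ker (adjoint (structmap D))).
elim: j T => [|j IHj] T T1 T2 MD;
  have [TL [TF [f [g [fg TFproj [I TFI]]]]]] := tri_presentation T;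
  have [f1 [f2 [fE fc]]] := tri_map_elim f;
  have [g1 [g2 [gE _]]] := tri_map_elim g;
  have [fg1 fg2] := (tri_ses fE gE).1 fg; last first.
  apply: (vanishS_intro Dadm fg TFproj); apply: IHj.
  - apply: (vanish_sub Zadm fg1 _ T1).
    exact/(vanish_iso TFI)/ext_vanish_fst_free/MD.
  - apply: (vanish_sub Kadm fg2 _ T2).
    exact/(vanish_projective Kadm)/snd_projective.
  - by move=> i ij; apply: MD; exact: ltnW.
apply: (vanish0_intro Dadm fg TFproj) => h.
have [h1 [h2 [hE hc]]] := tri_map_elim h.
have [k1 k1E] := vanish0_ses Zadm fg1 T1 h1.
have [|q qE] := @tri_map_intro _ _ _ D (hom_triple (fstc D)) idfun
    (adjoint (structmap D)).
  by move=> m y; rewrite /= lift_mapE.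
have [|r rE] := @tri_map_intro _ _ _ TF (hom_triple (fstc D)) k1
    (adjoint (k1 \o structmap TF)).
  by move=> m y; rewrite /= lift_mapE.
have [|k kE] := TFproj _ _ q r.
  by apply/(tri_epi qE); split=> // x; exists x.
have [k1' [k2 [kc kcompat]]] := tri_map_elim k.
(* The second component is the map [adjoint] into [Hom (M, Z)], so the first
   component of the lift is [k1] itself. *)
have k1'E x : k1' x = k1 x by have := kE (x, 0); rewrite kc qE rE => -[].
pose e2 : {linear sndc TL -> sndc D} := h2 \- (k2 \o f2).
have e2E y : e2 y = h2 y - k2 (f2 y) by [].
(* [k1] determines the transposes of both [h2] and [k2 \o f2], so their
   difference takes values in the kernel. *)
have [|e eE] := @factor_mono _ _ _ _
    (val : {linear ker (adjoint (structmap D)) -> _}) e2 val_inj.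
  move=> y; apply: kerP; rewrite e2E linearB /=; apply/eqP; rewrite subr_eq0.
  apply/eqP/hom_eq => m; rewrite /hom_fun /= /adjoint_fun.
  by rewrite -hc -kcompat k1'E -fc k1E.
have [e' e'E] := vanish0_ses Kadm fg2 T2 e.
pose l2 : {linear sndc TF -> sndc D} := k2 \+ (val \o e').
have l2E y : l2 y = k2 y + val (e' y) by [].
have [|l lE] := @tri_map_intro _ _ _ TF D k1 l2.
  move=> m y; rewrite l2E pureDr linearD /= -kcompat k1'E.
  have /(congr1 (fun a => hom_fun a m)) := val_ker (e' y).
  by rewrite /hom_fun /= /adjoint_fun => ->; rewrite addr0.
exists l => [[x y]]; rewrite fE lE hE k1E l2E e'E eE e2E.
by rewrite addrC subrK.
Qed.

Lemma fst_triple_projective X : projective X -> projective (tri_mod (fst_triple X)).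
Proof.
move=> Xproj; apply: tri_projective => U V g f ge.
have [g1 [g2 [gE _]]] := tri_map_elim g; have [f1 [f2 [fE _]]] := tri_map_elim f.
have [g1e _] := (tri_epi gE).1 ge; have [h1 h1E] := Xproj _ _ g1 f1 g1e.
have [|h hE] := @tri_map_intro _ _ _ (fst_triple X) U h1 (zero_map _ _).
  by move=> m y /=; rewrite linear0 pure0r linear0.
exists h => [[x y]]; rewrite hE gE fE h1E linear0.
by rewrite (zero_mod0 y) linear0.
Qed.

Lemma fst_triple_ses (K P A : lmodType R) (i : {linear K -> P}) (p : {linear P -> A}) :
  short_exact i p -> exists (f : {linear tri_mod (fst_triple K) -> tri_mod (fst_triple P)})
    (g : {linear tri_mod (fst_triple P) -> tri_mod (fst_triple A)}),
  [/\ short_exact f g, tri_comps f i idfun & tri_comps g p idfun].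
Proof.
move=> ip.
have [|f fE] := @tri_map_intro _ _ _ (fst_triple K) (fst_triple P) i idfun.
  by move=> m y /=; rewrite linear0.
have [|g gE] := @tri_map_intro _ _ _ (fst_triple P) (fst_triple A) p idfun.
  by move=> m y /=; rewrite linear0.
exists f, g; split=> //; apply/(tri_ses fE gE); split=> //.
exact/ses_id_zero/zero_mod0.
Qed.

(** [X |-> (X, 0)] is exact and left adjoint to the exact functor of the first
    component. *)
Lemma ext_vanish_fst_triple j X D :
  ext_vanish (fstc D) j X -> ext_vanish (tri_mod D) j (tri_mod (fst_triple X)).
Proof.
have Dadm := extends_along_admissible (tri_mod D).
elim: j X => [|j IHj] X XD; have [K [P [i [p [ip Pproj]]]]] := presentation X;
  have [f [g [fg fE gE]]] := fst_triple_ses ip;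
  have FP := fst_triple_projective Pproj.
  apply: (vanish0_intro Dadm fg FP) => h.
  have [h1 [h2 [hE _]]] := tri_map_elim h.
  have [k1 k1E] := XD _ _ _ _ ip Pproj h1.
  have [|k kE] := @tri_map_intro _ _ _ (fst_triple P) D k1 (zero_map _ _).
    by move=> m y /=; rewrite linear0 pure0r linear0.
  exists k => [[x y]]; rewrite fE kE hE k1E.
  by rewrite (zero_mod0 y) !linear0.
exact/(vanishS_intro Dadm fg FP)/IHj/(XD _ _ _ _ ip Pproj).
Qed.

Lemma tensor_triple_projective Y :
  projective Y -> projective (tri_mod (tensor_triple Y)).
Proof.
move=> Yproj; apply: tri_projective => U V g f ge.
have [g1 [g2 [gE gc]]] := tri_map_elim g; have [f1 [f2 [fE fc]]] := tri_map_elim f.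
have [_ g2e] := (tri_epi gE).1 ge; have [h2 h2E] := Yproj _ _ g2 f2 g2e.
have [|h hE] := @tri_map_intro _ _ _ (tensor_triple Y) U
    (structmap U \o tensor_map h2) h2.
  by move=> m y /=; rewrite tensor_map_pure.
exists h => [[x y]]; rewrite hE gE fE h2E; congr (_, _).
rewrite -[LHS]/((g1 \o (structmap U \o tensor_map h2)) x).
apply: tensor_ext => m z /=.
by rewrite tensor_map_pure gc h2E -fc.
Qed.

Lemma tensor_triple_ses (K P A : lmodType S) (i : {linear K -> P}) (p : {linear P -> A}) :
  short_exact i p -> stays_mono M i ->
  exists (f : {linear tri_mod (tensor_triple K) -> tri_mod (tensor_triple P)})
    (g : {linear tri_mod (tensor_triple P) -> tri_mod (tensor_triple A)}),
  short_exact f g.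
Proof.
move=> ip im.
have [|f fE] := @tri_map_intro _ _ _ (tensor_triple K) (tensor_triple P) (tensor_map i) i.
  by move=> m y /=; rewrite tensor_map_pure.
have [|g gE] := @tri_map_intro _ _ _ (tensor_triple P) (tensor_triple A) (tensor_map p) p.
  by move=> m y /=; rewrite tensor_map_pure.
exists f, g; apply/(tri_ses fE gE); split=> //.
by have [ex e] := tensor_right_exact M ip.
Qed.

(** [Y |-> (M (x) Y, Y)] is left adjoint to the second component.  Let [L] be
    a syzygy of [Y] in a projective [Q].  Vanishing of Tor keeps [M (x) L] inside
    [M (x) Q], so that the syzygy of [(M (x) Y, Y)] has the same form and the
    degree goes down.  In degree 1 right exactness suffices: the kernel of
    [M (x) Q -> M (x) Y] is the image of [M (x) L], on which a map of triples is
    determined by its second component. *)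
Lemma ext_vanish_tensor_triple j Y D :
    ext_vanish (sndc D) j Y -> (forall i, (i < j)%N -> tor_vanish M i Y) ->
  ext_vanish (tri_mod D) j (tri_mod (tensor_triple Y)).
Proof.
have Dadm := extends_along_admissible (tri_mod D).
have Tadm := stays_mono_admissible M.
elim: j Y => [|j IHj] Y YD YM; have [K [P [i [p [ip Pproj]]]]] := presentation Y;
  have FP := tensor_triple_projective Pproj; last first.
  have [f [g fg]] := tensor_triple_ses ip (vanish0_ses Tadm ip (YM 0 isT)).
  apply: (vanishS_intro Dadm fg FP); apply: IHj; first exact: YD ip Pproj.
  by move=> k kj; exact: (YM k.+1 kj _ _ _ _ ip Pproj).
have [ex e] := tensor_right_exact M ip.
have [|s sE] := @factor_mono _ _ _ _
    (val : {linear ker (tensor_map p : {linear tensor M P -> _}) -> _})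
    (tensor_map i) val_inj.
  by move=> u; apply: kerP; apply/ex; exists u.
have se : epi s.
  move=> t; have [u uE] := (ex (val t)).1 (val_ker t).
  by exists u; apply: val_inj; rewrite sE.
have [|f fE] := @tri_map_intro _ _ _ (Triple s) (tensor_triple P) val i.
  by move=> m y /=; rewrite [LHS]sE /= tensor_map_pure.
have [|g gE] := @tri_map_intro _ _ _ (tensor_triple P) (tensor_triple Y) (tensor_map p) p.
  by move=> m y /=; rewrite tensor_map_pure.
have fg : short_exact f g.
  by apply/(tri_ses fE gE); split=> //; exact: ses_ker.
apply: (vanish0_intro Dadm fg FP) => h.
have [h1 [h2 [hE hc]]] := tri_map_elim h.
have [k2 k2E] := YD _ _ _ _ ip Pproj h2.
have [|k kE] := @tri_map_intro _ _ _ (tensor_triple P) D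
    (structmap D \o tensor_map k2) k2.
  by move=> m y /=; rewrite tensor_map_pure.
exists k => [[t y]]; rewrite fE kE hE k2E; congr (_, _).
have [u <-] := se t; rewrite /= [val (s u)]sE /= -(tensor_map_comp (h := h2)) //.
rewrite -[LHS]/((structmap D \o tensor_map h2) u) -[RHS]/((h1 \o s) u).
by apply: tensor_ext => m z /=; rewrite tensor_map_pure -hc.
Qed.

(** The extension that makes [T] with injective structure map accessible from
    the two adjoint functors [Y |-> (M (x) Y, Y)] and [X |-> (X, 0)]. *)
Lemma structmap_ses T : mono (structmap T) ->
  exists (f : {linear tri_mod (tensor_triple (sndc T)) -> tri_mod T})
    (g : {linear tri_mod T -> tri_mod (fst_triple (coker (structmap T)))}),
  short_exact f g.
Proof.
move=> sm.
have [|f fE] := @tri_map_intro _ _ _ (tensor_triple (sndc T)) T (structmap T) idfun.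
  by [].
have [|g gE] := @tri_map_intro _ _ _ T (fst_triple (coker (structmap T)))
    (coker_proj (structmap T)) (zero_map _ _).
  by move=> m y /=; apply/coker_proj_eq0; exists (pure m y).
exists f, g; apply/(tri_ses fE gE); split; first exact: ses_coker.
exact/ses_id_to_zero/zero_mod0.
Qed.

Lemma ext_vanish_mono_structmap j T D :
    mono (structmap T) ->
    ext_vanish (fstc D) j (coker (structmap T)) ->
    ext_vanish (sndc D) j (sndc T) ->
    (forall i, (i < j)%N -> tor_vanish M i (sndc T)) ->
  ext_vanish (tri_mod D) j (tri_mod T).
Proof.
move=> sm XD YD YM; have [f [g fg]] := structmap_ses sm.
apply: (vanish_ext (extends_along_admissible _) fg).
  exact: ext_vanish_tensor_triple.
exact: ext_vanish_fst_triple.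
Qed.

End TriangularExt.

(** * Classes of modules over the triangular ring *)

Lemma cotorsion_ext_vanish (R : pzRingType) n (C D : modclass R) :
    (forall i, (1 <= i <= n)%N -> forall U V, C U -> D V -> Ext_zero i U V) ->
    hereditary n C D ->
  forall j, (j <= n)%N -> forall U V, C U -> D V -> ext_vanish V j U.
Proof.
move=> CD her j jn U V CU DV; apply/Ext_zero_vanish.
move: jn; rewrite leq_eqVlt => /orP[/eqP->|jn]; first exact: her.
exact: CD.
Qed.

Section TriangularCotorsion.
Variables (R S : pzRingType) (M : bimodType R S).
Variables (clX clM : modclass R) (clY clN : modclass S).
Hypotheses (clX_class : class_axioms clX) (clM_class : class_axioms clM).
Hypotheses (clY_class : class_axioms clY) (clN_class : class_axioms clN).
Implicit Types T : triple M.

Lemma tri_class_mod (Q : triple M -> Prop) T : Q T -> tri_class Q (tri_mod T).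
Proof. by move=> QT; exists T; split=> //; exact: lmod_iso_refl. Qed.

(** A direct sum of triples is formed componentwise. *)
Lemma col_closed_summands (P : modclass R) (Q : modclass S) :
  closed_summands P -> closed_summands Q -> closed_summands (col_class M P Q).
Proof.
move=> sP sQ U V W WUV [T [[PT QT] TW]].
have [f [fm fe]] := lmod_iso_trans TW WUV.
have [TU TUU] := tri_mod_exists U; have [u [um ue]] := lmod_iso_sym TUU.
have [TV /lmod_iso_sym[v [vm ve]]] := tri_mod_exists V.
have [a1 [a2 [aE _]]] := tri_map_elim (u \o fst \o f).
have [b1 [b2 [bE _]]] := tri_map_elim (v \o snd \o f).
have inj x y : a1 x = 0 -> b1 x = 0 -> a2 y = 0 -> b2 y = 0 -> (x, y) = 0 :> tri_mod T.
  move=> ax bx ay by0; apply: (mono_eq0 fm).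
  have := aE x y; have := bE x y; rewrite ax bx ay by0 /=.
  move=> /(mono_eq0 vm) v0 /(mono_eq0 um) u0.
  by case: (f _) u0 v0 => ? ? /= -> ->.
have sur w z : exists x y, [/\ a1 x = w.1, a2 y = w.2, b1 x = z.1 & b2 y = z.2].
  have [w' <-] := ue w; have [z' <-] := ve z; have [[x y] xy] := fe (w', z').
  by exists x, y; have := aE x y; have := bE x y; rewrite /= xy /= => -> ->.
exists TU; split=> //; split.
- apply: (sP _ (fstc TV) (fstc T)) PT.
  have pl : linear (fun x => (a1 x, b1 x)).
    by move=> c x y; congr (_, _); rewrite /= linearP.
  exists (mk_linear pl); split.
    apply: mono_ker0 => x [ax bx]; have := inj x 0 ax bx (linear0 _) (linear0 _).
    by case.
  move=> [w z]; have [x [y [ax _ bx _]]] := sur (w, 0) (z, 0).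
  by exists x; rewrite mk_linearE ax bx.
- apply: (sQ _ (sndc TV) (sndc T)) QT.
  have pl : linear (fun x => (a2 x, b2 x)).
    by move=> c x y; congr (_, _); rewrite /= linearP.
  exists (mk_linear pl); split.
    apply: mono_ker0 => y [ay by0]; have := inj 0 y (linear0 _) (linear0 _) ay by0.
    by case.
  move=> [w z]; have [x [y [_ ay _ by0]]] := sur (0, w) (0, z).
  by exists y; rewrite mk_linearE ay by0.
Qed.

(** * The left pair over the triangular ring *)

Lemma D_resolved_snd m N :
  resolved clN m N -> resolved (D_class M clM clN) m (tri_mod (snd_triple M N)).
Proof.
have base B : clN B -> D_class M clM clN (tri_mod (snd_triple M B)).
  move=> NB; apply: tri_class_mod; split.
  - exact: (clM_class.1 _ (@zero_mod0 R)).
  - apply: (clN_class.2 _ _ _ NB); apply: lmod_iso_sym.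
    exists (val : {linear ker (adjoint (structmap (snd_triple M B))) -> _}).
    split=> [|y]; first exact: val_inj.
    by apply: kerP; apply: hom_eq => m'; exact: zero_mod0.
  - by apply/coker_zeroP => h; exists 0; apply: hom_eq => m'; apply: etrans (zero_mod0 _) (esym (zero_mod0 _)).
elim: m N => [|m IHm] N [NN|] //=; try by left; exact: base.
move=> [K [U [i [p [ip NU /IHm DK]]]]]; right.
have [|f fE] := @tri_map_intro _ _ _ (snd_triple M K) (snd_triple M U) idfun i.
  by [].
have [|g gE] := @tri_map_intro _ _ _ (snd_triple M U) (snd_triple M N) idfun p.
  by [].
exists (tri_mod (snd_triple M K)), (tri_mod (snd_triple M U)), f, g; split=> //.
  apply/(tri_ses fE gE); split=> //; exact/ses_id_zero/zero_mod0.
exact: base.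
Qed.

Lemma hom_map_linear (X X' : lmodType R) (f : {linear X -> X'}) :
  linear (fun h : hom_mod M X => (f \o (h : {linear M -> X}) : {linear M -> X'}) : hom_mod M X').
Proof.
by move=> s h k; apply: hom_eq => m; rewrite /hom_fun /= linearD.
Qed.

Definition hom_map (X X' : lmodType R) (f : {linear X -> X'}) :
  {linear hom_mod M X -> hom_mod M X'} := mk_linear (hom_map_linear f).

Lemma hom_mapE (X X' : lmodType R) (f : {linear X -> X'}) h m :
  hom_fun (hom_map f h) m = f (hom_fun h m).
Proof. by []. Qed.

Lemma hom_ses (K U Z : lmodType R) (i : {linear K -> U}) (p : {linear U -> Z}) :
  short_exact i p -> ext_vanish K 0 (M : lmodType R) ->
  short_exact (hom_map i) (hom_map p).
Proof.
move=> ip MK; have [im ex pe] := ip; split=> [h k hk|h|h].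
- by apply: hom_eq => m; apply: im; rewrite -!hom_mapE hk.
- split=> [ph|[k <-]]; last first.
    by apply: hom_eq => m; rewrite !hom_mapE (ses_comp0 _ ip).
  have [|k kE] := @factor_mono _ _ _ _ i (h : {linear M -> U}) im.
    by move=> m; apply/ex; have := congr1 (fun l => hom_fun l m) ph.
  by exists k; apply: hom_eq => m; exact: kE.
- have [k kE] := ext_vanish0_lift (h : {linear M -> Z}) ip MK.
  by exists k; apply: hom_eq => m; exact: kE.
Qed.

Lemma adjoint_hom_triple Z (h : hom_mod M Z) :
  adjoint (structmap (hom_triple M Z)) h = h.
Proof. by apply: hom_eq => m; rewrite [LHS]lift_mapE. Qed.

(** [Z |-> (Z, Hom (M, Z))] is exact on the resolution of [Z]: the vanishing of
    Ext from [M] passes to the successive cokernels, one degree less at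
    each step, and the resolution is short enough. *)
Lemma D_resolved_hom n m Z :
    (forall j, (j < n)%N -> forall Z', clM Z' -> ext_vanish Z' j (M : lmodType R)) ->
    (m < n)%N -> resolved clM m Z ->
  resolved (D_class M clM clN) m (tri_mod (hom_triple M Z)) /\
  forall j, (j < n - m)%N -> ext_vanish Z j (M : lmodType R).
Proof.
move=> Mext.
have base B : clM B -> D_class M clM clN (tri_mod (hom_triple M B)).
  move=> MB; apply: tri_class_mod; split=> //.
    apply: clN_class.1; apply/ker_zeroP => h k hk.
    by rewrite -[h]adjoint_hom_triple -[k]adjoint_hom_triple; exact: hk.
  by apply/coker_zeroP => h; exists h; exact: adjoint_hom_triple.
have baseM m' B : clM B -> forall j, (j < n - m')%N -> ext_vanish B j (M : lmodType R).
  by move=> MB j jn; apply: Mext => //; apply: leq_trans jn _; exact: leq_subr.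
elim: m Z => [|m IHm] Z mn [MZ|] //.
- by split; [left; exact: base|exact: baseM].
- by split; [left; exact: base|exact: baseM].
move=> [K [U [i [p [ip MU Kres]]]]].
have [DK KM] := IHm _ (ltnW mn) Kres; split; last first.
  move=> j jn; apply: (ext_vanish_quotient ip).
    by apply: Mext => //; apply: leq_trans jn _; exact: leq_subr.
  by apply: KM; rewrite ltn_subRL addnS -addSn -ltn_subRL.
have K0 : ext_vanish K 0 (M : lmodType R) by apply: KM; rewrite subn_gt0 ltnW.
right; have [|f fE] := @tri_map_intro _ _ _ (hom_triple M K) (hom_triple M U) i (hom_map i).
  by move=> m' y; rewrite /= !lift_mapE.
have [|g gE] := @tri_map_intro _ _ _ (hom_triple M U) (hom_triple M Z) p (hom_map p).
  by move=> m' y; rewrite /= !lift_mapE.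
exists (tri_mod (hom_triple M K)), (tri_mod (hom_triple M U)), f, g; split=> //.
  by apply/(tri_ses fE gE); split=> //; exact: hom_ses.
exact: base.
Qed.

(** Let [M' -> X -> A1] and [T = (A1, A2)].  As Ext from [M] to [M'] vanishes in
    degree 1, [Hom (M, X) -> Hom (M, A1)] is onto with kernel [Hom (M, M')], and
    so is the projection to [A2] of the pullback [Q] of [A2] and [Hom (M, X)].
    With [N' -> Y -> Q], the composite [Y -> Hom (M, X)] makes [(X, Y)]
    a triple that maps onto [T].  The kernel has the components [M'] and
    [Y'], where [Y'] is an extension of [Hom (M, M')] by [N']: it is thus an
    extension of [(M', Hom (M, M'))] by [(0, N')]. *)
Lemma left_approximation n T :
    (1 <= n)%N ->
    (forall j, (j < n)%N -> forall Z', clM Z' -> ext_vanish Z' j (M : lmodType R)) ->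
    (forall A : lmodType R, exists (K U : lmodType R)
        (f : {linear K -> U}) (g : {linear U -> A}),
        [/\ short_exact f g, clX U & wedge clM n.-1 K]) ->
    (forall A : lmodType S, exists (K U : lmodType S)
        (f : {linear K -> U}) (g : {linear U -> A}),
        [/\ short_exact f g, clY U & wedge clN n.-1 K]) ->
    closed_extensions (wedge (D_class M clM clN) n.-1) ->
  exists (K C : triple M) (f : {linear tri_mod K -> tri_mod C})
    (g : {linear tri_mod C -> tri_mod T}),
    [/\ short_exact f g, clX (fstc C), clY (sndc C) &
        wedge (D_class M clM clN) n.-1 (tri_mod K)].
Proof.
move=> n1 Mext appX appY Dext.
have [M' [X [i [p [ip XX /wedge_resolved M'res]]]]] := appX (fstc T).
have n'n : (n.-1 < n)%N by rewrite prednK.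
have [DM' M'M] := D_resolved_hom Mext n'n (M'res clM_class.2).
have M'0 : ext_vanish M' 0 (M : lmodType R) by apply: M'M; rewrite subn_gt0.
have hip := hom_ses ip M'0.
have [Q [x [b [xb mk inj]]]] := pullback (hom_map p) (adjoint (structmap T)).
have [k [kb xk]] := pullback_kernel hip xb mk inj.
have [N' [Y [l [q [lq YY /wedge_resolved N'res]]]]] := appY Q.
have [Y' [v [l' [q' [s1 s2 vl' kq']]]]] := rotate_ses kb lq.
pose C : triple M := Triple (lift_map (x \o q)).
pose K : triple M := Triple (lift_map q').
have CE m y : structmap C (pure m y) = hom_fun (x (q y)) m by exact: lift_mapE.
have KE m y : structmap K (pure m y) = hom_fun (q' y) m by exact: lift_mapE.
have [|f fE] := @tri_map_intro _ _ _ K C i v.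
  by move=> m y; rewrite CE KE -kq' xk.
have [|g gE] := @tri_map_intro _ _ _ C T p (b \o q).
  by move=> m y; rewrite CE -hom_mapE xb.
exists K, C, f, g; split=> //; first by apply/(tri_ses fE gE).
have [|f' f'E] := @tri_map_intro _ _ _ (snd_triple M N') K (zero_map _ _) l'.
  by move=> m y; rewrite KE (ses_comp0 _ s2).
have [|g' g'E] := @tri_map_intro _ _ _ K (hom_triple M M') idfun q'.
  by move=> m y; rewrite KE /= lift_mapE.
apply: (Dext _ _ _ f' g').
- by apply/(tri_ses f'E g'E); split=> //; exact/ses_zero_id/zero_mod0.
- exact/resolved_wedge/D_resolved_snd/N'res/clN_class.2.
- exact/resolved_wedge.
Qed.

Lemma left_cotorsion_triangular n : (1 <= n)%N ->
  left_cotorsion n clX clM -> hereditary n clX clM ->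
  left_cotorsion n clY clN -> hereditary n clY clN ->
  (forall j, (1 <= j <= n)%N ->
     forall Z : lmodType R, clM Z -> Ext_zero j (M : lmodType R) Z) ->
  closed_extensions (wedge (D_class M clM clN) n.-1) ->
  left_cotorsion n (col_class M clX clY) (D_class M clM clN) /\
  hereditary n (col_class M clX clY) (D_class M clM clN).
Proof.
move=> n1 [sX extX appX] herX [sY extY appY] herY MExt Dext.
have Mext j : (j < n)%N -> forall Z', clM Z' -> ext_vanish Z' j (M : lmodType R).
  by move=> jn Z' MZ'; apply/Ext_zero_vanish; exact: MExt.
have ext j : (j <= n)%N -> forall U V, col_class M clX clY U ->
    D_class M clM clN V -> Ext_zero j.+1 U V.
  move=> jn U V [T [[XT YT] TU]] [D [[MD ND cD] DV]].
  apply/Ext_zero_vanish/(vanish_iso TU)/(ext_vanish_iso DV).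
  apply: ext_vanish_epi_adjoint; first exact/coker_zeroP.
  - exact: cotorsion_ext_vanish extX herX _ jn _ _ XT MD.
  - exact: cotorsion_ext_vanish extY herY _ jn _ _ YT ND.
  - by move=> i ij; apply: Mext => //; exact: leq_trans ij jn.
split; last by move=> U V; exact: ext.
split; first exact: col_closed_summands.
  by move=> [|i] // /andP[_ /ltnW]; exact: ext.
move=> A; have [T [s [sm se]]] := tri_mod_exists A.
have [K [C [f [g [fg XC YC DK]]]]] := left_approximation T n1 Mext appX appY Dext.
exists (tri_mod K), (tri_mod C), f, (s \o g); split=> //; first exact: ses_isor.
exact: tri_class_mod.
Qed.

(** * The right pair over the triangular ring *)

Lemma B_coresolved_fst m X :
  coresolved clX m X -> coresolved (B_class M clX clY) m (tri_mod (fst_triple M X)).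
Proof.
have base B : clX B -> B_class M clX clY (tri_mod (fst_triple M B)).
  move=> XB; apply: tri_class_mod; split.
  - exact: (clY_class.1 _ (@zero_mod0 S)).
  - apply/ker_zeroP => u v _.
    by have t0 := tensor_zero_mod (M := M) (@zero_mod0 S); rewrite (t0 u) (t0 v).
  - apply: (clX_class.2 _ _ _ XB).
    exists (coker_proj (structmap (fst_triple M B))).
    split; last exact: coker_proj_epi.
    by apply: mono_ker0 => x /coker_proj_eq0[u <-].
elim: m X => [|m IHm] X [XX|] //=; try by left; exact: base.
move=> [U [K [i [p [ip XU /IHm BK]]]]]; right.
have [f [g [fg _ _]]] := fst_triple_ses M ip.
exists (tri_mod (fst_triple M U)), (tri_mod (fst_triple M K)), f, g; split=> //.
exact: base.
Qed.

(** Dually, [Y |-> (M (x) Y, Y)] is exact on the coresolution of [Y]. *)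
Lemma B_coresolved_tensor n m Y :
    (forall j, (j < n)%N -> forall Y', clY Y' -> tor_vanish M j Y') ->
    (m < n)%N -> coresolved clY m Y ->
  coresolved (B_class M clX clY) m (tri_mod (tensor_triple M Y)) /\
  forall j, (j < n - m)%N -> tor_vanish M j Y.
Proof.
move=> Mtor; have Tadm := stays_mono_admissible M.
have base B : clY B -> B_class M clX clY (tri_mod (tensor_triple M B)).
  move=> YB; apply: tri_class_mod; split=> //.
    by apply/ker_zeroP => u v.
  by apply: clX_class.1; apply/coker_zeroP => u; exists u.
have baseM m' B : clY B -> forall j, (j < n - m')%N -> tor_vanish M j B.
  by move=> YB j jn; apply: Mtor => //; apply: leq_trans jn _; exact: leq_subr.
elim: m Y => [|m IHm] Y mn [YY|] //.
- by split; [left; exact: base|exact: baseM].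
- by split; [left; exact: base|exact: baseM].
move=> [U [K [i [p [ip YU Kres]]]]].
have [BK KM] := IHm _ (ltnW mn) Kres; split; last first.
  move=> j jn; have Kj : tor_vanish M j.+1 K.
    by apply: KM; rewrite ltn_subRL addnS -addSn -ltn_subRL.
  apply: (vanish_sub Tadm ip _ Kj).
  by apply: Mtor => //; apply: leq_trans jn _; exact: leq_subr.
have K0 : tor_vanish M 0 K by apply: KM; rewrite subn_gt0 ltnW.
right; have [f [g fg]] := tensor_triple_ses ip (vanish0_ses Tadm ip K0).
exists (tri_mod (tensor_triple M U)), (tri_mod (tensor_triple M K)), f, g; split=> //.
exact: base.
Qed.

Lemma pushout (Q : pzRingType) (U P V : lmodType Q) (f : {linear U -> P})
    (g : {linear U -> V}) :
  exists (E : lmodType Q) (a : {linear P -> E}) (b : {linear V -> E}),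
    [/\ forall u, a (f u) = b (g u),
        forall e, exists x y, e = a x + b y &
        forall x y, a x = b y -> exists u, f u = x /\ g u = y].
Proof.
have dl : linear (fun u => (f u, - g u)).
  by move=> c u v; congr (_, _); rewrite /= ?linearP // opprD scalerN.
have al : linear (fun x : P => (x, 0 : V)).
  by move=> c x y; congr (_, _); rewrite /= scaler0 addr0.
have bl : linear (fun y : V => (0 : P, y)).
  by move=> c x y; congr (_, _); rewrite /= scaler0 addr0.
pose c := coker_proj (mk_linear dl).
exists (coker (mk_linear dl)), (c \o mk_linear al), (c \o mk_linear bl); split.
- move=> u; apply/coker_proj_eq; exists u.
  by congr (_, _); rewrite /= ?subr0 ?sub0r.
- move=> e; have [[x y] <-] := coker_proj_epi e; exists x, y.
  rewrite /= -linearD; congr (coker_proj _ _).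
  by congr (_, _); rewrite /= ?addr0 ?add0r.
- move=> x y /coker_proj_eq[u uE]; exists u.
  have := congr1 fst uE; have := congr1 snd uE.
  by rewrite /= subr0 sub0r => /oppr_inj.
Qed.

(** Dually, let [A2 -> W -> Y'] and [T = (A1, A2)].  As Tor vanishes on [Y'] in
    degree 1, [M (x) A2] embeds in [M (x) W], and [A1] in the pushout [Q] of
    [A1] and [M (x) W].  With [Q -> Z -> X'], the triple [(Z, W)] contains [T],
    and the cokernel is an extension of [(X', 0)] by [(M (x) Y', Y')]. *)
Lemma right_approximation n T :
    (1 <= n)%N ->
    (forall j, (j < n)%N -> forall Y', clY Y' -> tor_vanish M j Y') ->
    (forall A : lmodType R, exists (V K : lmodType R)
        (f : {linear A -> V}) (g : {linear V -> K}),
        [/\ short_exact f g, clM V & vee clX n.-1 K]) ->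
    (forall A : lmodType S, exists (V K : lmodType S)
        (f : {linear A -> V}) (g : {linear V -> K}),
        [/\ short_exact f g, clN V & vee clY n.-1 K]) ->
    closed_extensions (vee (B_class M clX clY) n.-1) ->
  exists (D K : triple M) (f : {linear tri_mod T -> tri_mod D})
    (g : {linear tri_mod D -> tri_mod K}),
    [/\ short_exact f g, clM (fstc D), clN (sndc D) &
        vee (B_class M clX clY) n.-1 (tri_mod K)].
Proof.
move=> n1 Mtor appX appY Bext.
have [W [Y' [f2 [g2 [fg2 NW /vee_coresolved Y'res]]]]] := appY (sndc T).
have n'n : (n.-1 < n)%N by rewrite prednK.
have [BY' Y'M] := B_coresolved_tensor Mtor n'n (Y'res clY_class.2).
have Y'0 : tor_vanish M 0 Y' by apply: Y'M; rewrite subn_gt0.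
have f2m : stays_mono M f2 := vanish0_ses (stays_mono_admissible M) fg2 Y'0.
have [ex2 e2] := tensor_right_exact M fg2.
have [Q [a [b [ab abe abk]]]] := pushout (structmap T) (tensor_map f2).
have am : mono a.
  apply: mono_ker0 => x ax; have [|u [<- /(mono_eq0 f2m)->]] := abk x 0.
    by rewrite ax linear0.
  by rewrite linear0.
have [Z [X' [i [p [ip MZ /vee_coresolved X'res]]]]] := appX Q.
have [im exi pe] := ip.
pose D : triple M := Triple (i \o b).
pose c := coker_proj (i \o a).
have [|k kE] := @factor_epi _ _ _ _ (tensor_map g2) (c \o (i \o b)) e2.
  move=> u /ex2[w <-]; apply/coker_proj_eq0; exists (structmap T w).
  by rewrite /= ab.
pose K : triple M := Triple k.
have [|f fE] := @tri_map_intro _ _ _ T D (i \o a) f2.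
  by move=> m y; rewrite /= ab /= tensor_map_pure.
have [|g gE] := @tri_map_intro _ _ _ D K c g2.
  by move=> m y; rewrite /= -tensor_map_pure [RHS]kE.
exists D, K, f, g; split=> //.
  by apply/(tri_ses fE gE); split=> //; apply: ses_coker => x y /im/am.
have [|r rE] := @factor_epi _ _ _ _ c p (@coker_proj_epi _ _ _ _).
  by move=> z /coker_proj_eq0[x <-]; rewrite /= (ses_comp0 _ ip).
have kr : short_exact k r.
  split.
  - apply: mono_ker0 => t; have [u <-] := e2 t; rewrite kE => /coker_proj_eq0[x].
    by move=> /im/abk[w [_ wu]]; apply/ex2; exists w.
  - move=> t; split=> [|[s <-]]; last first.
      by have [u <-] := e2 s; rewrite kE /= rE (ses_comp0 _ ip).
    have [z <-] := coker_proj_epi t; rewrite [r _]rE => /exi[e <-].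
    have [x [u ->]] := abe e; exists (tensor_map g2 u); rewrite kE /=.
    by apply/coker_proj_eq; exists (- x); rewrite /= linearD opprD addrCA subrr addr0 !linearN.
  - by move=> t; have [z <-] := pe t; exists (c z); rewrite rE.
have [|f' f'E] := @tri_map_intro _ _ _ (tensor_triple M Y') K k idfun.
  by [].
have [|g' g'E] := @tri_map_intro _ _ _ K (fst_triple M X') r (zero_map _ _).
  by move=> m y; exact: (ses_comp0 _ kr).
apply: (Bext _ _ _ f' g').
- by apply/(tri_ses f'E g'E); split=> //; exact/ses_id_to_zero/zero_mod0.
- exact/coresolved_vee.
- exact/coresolved_vee/B_coresolved_fst/X'res/clX_class.2.
Qed.

Lemma right_cotorsion_triangular n : (1 <= n)%N ->
  right_cotorsion n clX clM -> hereditary n clX clM ->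
  right_cotorsion n clY clN -> hereditary n clY clN ->
  (forall j, (1 <= j <= n)%N ->
     forall Z : lmodType S, clY Z -> Tor_zero j M Z) ->
  closed_extensions (vee (B_class M clX clY) n.-1) ->
  right_cotorsion n (B_class M clX clY) (col_class M clM clN) /\
  hereditary n (B_class M clX clY) (col_class M clM clN).
Proof.
move=> n1 [sM extX appX] herX [sN extY appY] herY MTor Bext.
have Mtor j : (j < n)%N -> forall Y', clY Y' -> tor_vanish M j Y'.
  by move=> jn Y' YY'; apply: Tor_zero_vanish; exact: MTor.
have ext j : (j <= n)%N -> forall U V, B_class M clX clY U ->
    col_class M clM clN V -> Ext_zero j.+1 U V.
  move=> jn U V [T [[YT kT XT] TU]] [D [[MD ND] DV]].
  apply/Ext_zero_vanish/(vanish_iso TU)/(ext_vanish_iso DV).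
  apply: ext_vanish_mono_structmap; first exact/ker_zeroP.
  - exact: cotorsion_ext_vanish extX herX _ jn _ _ XT MD.
  - exact: cotorsion_ext_vanish extY herY _ jn _ _ YT ND.
  - by move=> i ij; apply: Mtor => //; exact: leq_trans ij jn.
split; last by move=> U V; exact: ext.
split; first exact: col_closed_summands.
  by move=> [|i] // /andP[_ /ltnW]; exact: ext.
move=> A; have [T /lmod_iso_sym[s [sm se]]] := tri_mod_exists A.
have [D [K [f [g [fg MD ND BK]]]]] := right_approximation T n1 Mtor appX appY Bext.
exists (tri_mod D), (tri_mod K), (f \o s), g; split=> //; last exact: tri_class_mod.
have [fm ex ge] := fg; split=> // [x y /fm/sm //|v].
rewrite ex; split=> [[u <-]|[x <-]]; last by exists (s x).
by have [x <-] := se u; exists x.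
Qed.

End TriangularCotorsion.

Theorem proposition5p3 (R S : pzRingType) (M : bimodType R S) (n : nat)
    (n_ge1 : (1 <= n)%N)
    (clX clM : modclass R) (clY clN : modclass S)
    (clX_class : class_axioms clX) (clM_class : class_axioms clM)
    (clY_class : class_axioms clY) (clN_class : class_axioms clN) :
  (left_cotorsion n clX clM -> hereditary n clX clM ->
   left_cotorsion n clY clN -> hereditary n clY clN ->
   (forall j, (1 <= j <= n)%N ->
      forall Z : lmodType R, clM Z -> Ext_zero j (M : lmodType R) Z) ->
   closed_extensions (wedge (D_class M clM clN) n.-1) ->
   left_cotorsion n (col_class M clX clY) (D_class M clM clN) /\
   hereditary n (col_class M clX clY) (D_class M clM clN))
  /\
  (right_cotorsion n clX clM -> hereditary n clX clM ->
   right_cotorsion n clY clN -> hereditary n clY clN ->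
   (forall j, (1 <= j <= n)%N ->
      forall Z : lmodType S, clY Z -> Tor_zero j M Z) ->
   closed_extensions (vee (B_class M clX clY) n.-1) ->
   right_cotorsion n (B_class M clX clY) (col_class M clM clN) /\
   hereditary n (B_class M clX clY) (col_class M clM clN)).
Proof.
by split; [exact: left_cotorsion_triangular|exact: right_cotorsion_triangular].
Qed.
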